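(* Let $W$ be a weighted small-step walk in the quadrant with probability matrix $P_\infty$ and associated group $G_W$. The group $G_W$ is of order $8$ if and only if, up to the symmetries of the model, $$p_{11}=p_{01}=p_{-1,-1}=p_{0,-1}=0,\qquad p_{10}\,p_{-1,0}=p_{1,-1}\,p_{-1,1},\qquad p_{10}\,p_{1,-1}\,p_{-1,1}\neq0.$$ Equivalently, $G_W$ is of order $8$ if and only if, up to the symmetries of the model, $$P_\infty=\begin{pmatrix} 0 & p_{10} & p_{1,-1} \\ 0 & p_{00} & 0 \\ p_{-1,1} & \dfrac{p_{1,-1}p_{-1,1}}{p_{10}} & 0 \end{pmatrix},\qquad p_{10}\,p_{1,-1}\,p_{-1,1}\neq0.$$
   Context: A weighted small-step walk $W$ in the quadrant is given by real weights $p_{ij}\ge 0$, $i,j\in\{-1,0,1\}$, with $\sum_{i,j=-1}^{1}p_{ij}=1$. Its probability matrix is $$P_\infty=\begin{pmatrix} p_{11} & p_{10} & p_{1,-1} \\ p_{01} & p_{00} & p_{0,-1} \\ p_{-1,1} & p_{-1,0} & p_{-1,-1} \end{pmatrix}.$$ Its inventory is $$\chi_W(x,y)=\sum_{i,j=-1}^1 p_{ij}x^iy^j = xA_1(y)+B_1(y)+\frac{C_1(y)}{x}=yA_2(x)+B_2(x)+\frac{C_2(x)}{y},$$ where $A_1,B_1,C_1$ are Laurent polynomials in $y$ and $A_2,B_2,C_2$ are Laurent polynomials in $x$. It is assumed that none of $A_1,C_1,A_2,C_2$ is identically zero, so that $$\varphi_1(x,y)=\left(\frac{C_1(y)}{xA_1(y)},\,y\right),\qquad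 \varphi_2(x,y)=\left(x,\,\frac{C_2(x)}{yA_2(x)}\right)$$ are birational involutions of the $(x,y)$-plane. The group of $W$ is $G_W=\langle\varphi_1,\varphi_2\rangle$, the group of birational transformations of the $(x,y)$-plane generated by them. ''Up to the symmetries of the model'' means up to the action of the eight symmetries of the square on the index set $\{-1,0,1\}^2$ of the weights, generated by $(i,j)\mapsto(-i,j)$, $(i,j)\mapsto(i,-j)$ and $(i,j)\mapsto(j,i)$ (i.e. reversing the order of the rows, reversing the order of the columns, and transposing $P_\infty$). *)

(* Defs.v *)
From mathcomp Require Import all_boot all_order all_algebra.
From mathcomp Require Import classical_sets cardinality reals.
From mathcomp Require Import ring.
Set Implicit Arguments.
Unset Strict Implicit.
Unset Printing Implicit Defensive.
Import Order.TTheory GRing.Theory Num.Theory.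
Local Open Scope ring_scope.
Local Open Scope classical_set_scope.

(* In {poly {poly R}} the outer variable 'X stands for x and the inner one
   'Y = 'X%:P stands for y, as in polyXY, so that p.[a, b] is p(a, b). *)
Notation ratfun R := {fraction {poly {poly R}}}.

Definition cst (R : idomainType) (r : R) : ratfun R := tofrac r%:P%:P.
Definition ratX (R : idomainType) : ratfun R := tofrac 'X.
Definition ratY (R : idomainType) : ratfun R := tofrac 'Y.

(* A rational map of the (x,y)-plane is the pair of its components. *)
Notation ratmap R := (ratfun R * ratfun R)%type.

Definition eval_at (R : idomainType) (p : {poly {poly R}}) (m : ratmap R)
    : ratfun R :=
  (map_poly (map_poly (@cst R)) p).[m.1, m.2].

(* f(m.1, m.2); independent of the chosen fraction whenever m is dominant,
   in particular whenever m is birational. *)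
Definition subst (R : idomainType) (f : ratfun R) (m : ratmap R) : ratfun R :=
  eval_at \n_(repr f) m / eval_at \d_(repr f) m.

Definition ratmap_id (R : idomainType) : ratmap R := (ratX R, ratY R).

Definition ratmap_comp (R : idomainType) (f g : ratmap R) : ratmap R :=
  (subst f.1 g, subst f.2 g).

Definition ratmap_inverse (R : idomainType) (f g : ratmap R) : Prop :=
  ratmap_comp f g = ratmap_id R /\ ratmap_comp g f = ratmap_id R.

(* Subgroup generated by a set S of birational maps. *)
Inductive generated (R : idomainType) (S : set (ratmap R)) : set (ratmap R) :=
| generated_gen f : S f -> generated S f
| generated_id : generated S (ratmap_id R)
| generated_comp f g :
    generated S f -> generated S g -> generated S (ratmap_comp f g)
| generated_inv f g :
    generated S f -> ratmap_inverse f g -> generated S g.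

(* A walk is given by its probability matrix P, whose rows and columns are
   indexed in the order 1, 0, -1; weight P i j is p_{ij} for i, j in
   {-1, 0, 1}. *)
Definition step_index (i : int) : 'I_3 := inord `|1 - i|%N.

Definition weight (R : Type) (P : 'M[R]_3) (i j : int) : R :=
  P (step_index i) (step_index j).

Definition steps : seq int := [:: -1; 0; 1].

Definition weighted_walk (R : numDomainType) (P : 'M[R]_3) : Prop :=
  {in steps &, forall i j, 0 <= weight P i j} /\
  \sum_(i <- steps) \sum_(j <- steps) weight P i j = 1.

Lemma laurent_collect1 (F : fieldType) (c : int -> int -> F) (x y : F) :
  \sum_(i <- steps) \sum_(j <- steps) c i j * x ^ i * y ^ j =
  x * (\sum_(j <- steps) c 1 j * y ^ j) + \sum_(j <- steps) c 0 j * y ^ j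
  + (\sum_(j <- steps) c (-1) j * y ^ j) / x.
Proof. by rewrite /steps !big_cons !big_nil !expr1z !expr0z !exprN1; ring. Qed.

Lemma laurent_collect2 (F : fieldType) (c : int -> int -> F) (x y : F) :
  \sum_(i <- steps) \sum_(j <- steps) c i j * x ^ i * y ^ j =
  y * (\sum_(i <- steps) c i 1 * x ^ i) + \sum_(i <- steps) c i 0 * x ^ i
  + (\sum_(i <- steps) c i (-1) * x ^ i) / y.
Proof. by rewrite /steps !big_cons !big_nil !expr1z !expr0z !exprN1; ring. Qed.

Section Group.
Variables (R : idomainType) (P : 'M[R]_3).
Local Notation x := (ratX R).
Local Notation y := (ratY R).
Local Notation p i j := (cst (weight P i j)).

Definition inventory : ratfun R :=
  \sum_(i <- steps) \sum_(j <- steps) p i j * x ^ i * y ^ j.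

Definition coefA1 : ratfun R := \sum_(j <- steps) p 1 j * y ^ j.
Definition coefB1 : ratfun R := \sum_(j <- steps) p 0 j * y ^ j.
Definition coefC1 : ratfun R := \sum_(j <- steps) p (-1) j * y ^ j.
Definition coefA2 : ratfun R := \sum_(i <- steps) p i 1 * x ^ i.
Definition coefB2 : ratfun R := \sum_(i <- steps) p i 0 * x ^ i.
Definition coefC2 : ratfun R := \sum_(i <- steps) p i (-1) * x ^ i.

Lemma inventoryE1 : inventory = x * coefA1 + coefB1 + coefC1 / x.
Proof. exact: (laurent_collect1 (fun i j => p i j) x y). Qed.

Lemma inventoryE2 : inventory = y * coefA2 + coefB2 + coefC2 / y.
Proof. exact: (laurent_collect2 (fun i j => p i j) x y). Qed.

Definition phi1 : ratmap R := (coefC1 / (x * coefA1), y).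
Definition phi2 : ratmap R := (x, coefC2 / (y * coefA2)).

Definition walk_group : set (ratmap R) := generated [set phi1; phi2].

End Group.

(* The orbit of P under the symmetries of the square; the three generators
   being involutions, closing under inverses is not needed. *)
Inductive symmetric_to (R : Type) (P : 'M[R]_3) : 'M[R]_3 -> Prop :=
| sym_refl : symmetric_to P P
| sym_rows Q :
    symmetric_to P Q -> symmetric_to P (\matrix_(i, j) Q (rev_ord i) j)
| sym_cols Q :
    symmetric_to P Q -> symmetric_to P (\matrix_(i, j) Q i (rev_ord j))
| sym_tr Q : symmetric_to P Q -> symmetric_to P Q^T.

Definition mx3 (R : nmodType) (rows : seq (seq R)) : 'M[R]_3 :=
  \matrix_(i, j) (nth [::] rows i)`_j.

(* Main.v *)
Require Import Defs.
From HB Require Import structures.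
From mathcomp Require Import all_boot all_order all_algebra.
From mathcomp Require Import generic_quotient.
From mathcomp Require Import boolp classical_sets cardinality reals.
From mathcomp Require Import topology normedtype.
From mathcomp Require Import ring lra zify.
Set Implicit Arguments.
Unset Strict Implicit.
Unset Printing Implicit Defensive.
Import Order.TTheory GRing.Theory Num.Theory.
Import numFieldNormedType.Exports.
Local Open Scope ring_scope.
Local Open Scope classical_set_scope.
Local Open Scope card_scope.

(** Let alpha(y) = C1(y)/A1(y) and beta(x) = C2(x)/A2(x), so that phi1 and phi2
are (x, y) -> (alpha(y)/x, y) and (x, y) -> (x, beta(x)/y).  The weights are
nonnegative, hence alpha and beta are positive on positive arguments, and phi1
and phi2 act on the open quadrant as two involutions.  A rational function is
determined by its values on the quadrant, so the group of the walk is the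
group of bijections of the quadrant generated by these involutions
([card_generated]).  It is dihedral, and it has order 8 if and only if the
product u of the two involutions has order exactly 4 ([card_walk_group]).

To exploit u^4 = 1, follow curves x ~ a t^p, y ~ b t^q as t tends to 0 from
the right.  There is no cancellation among nonnegative weights, so the leading
terms along the orbit obey the same recursion as the points themselves, in the
semiring of leading terms, and they are 4-periodic as well
([leading_period]).  The exponents form a tropical dynamical system that only
depends on which weights vanish.  Its 4-periodicity is a finite test, which
leaves four families of supports up to symmetry ([tropical_classification]):

- monomial supports: the leading coefficients are 4-periodic only if
  p_{10} p_{-1,0} = p_{1,-1} p_{-1,1} ([monomial_support_product]).  Conversely
  alpha and beta are then monomials, and u has order 4 ([form_period4]);
- skew supports: the leading coefficients determine the weights up to a
  rescaling of x and y, and one rational orbit fails to close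
  ([skew_support_no_period4]);
- tripod supports: alpha has to be constant, which turns u^4 = 1 into u^2 = 1
  ([tripod_support_period2]);
- balanced supports: alpha and beta are perturbations e y / (quadratic) of
  constants, invariant under y -> h/y and x -> k/x.  If both perturbations are
  nonzero, the first-order expansion of the closing condition along the curve
  x = t, y = b is contradictory ([two_deformations]); if one of them vanishes,
  u^2 = 1 again ([balanced_support_period2]).

So only the monomial family contains walks for which u has order exactly 4. *)

(** * Groups generated by two involutions *)

Section Dihedral.
Variables (T : Type) (s t : T -> T).
Hypotheses (ssK : involutive s) (ttK : involutive t).

Let u z := t (s z).

Inductive dihedral : set (T -> T) :=
| dihedral_id : dihedral id
| dihedral_s f : dihedral f -> dihedral (s \o f)
| dihedral_t f : dihedral f -> dihedral (t \o f).

Lemma dihedral_comp f g : dihedral f -> dihedral g -> dihedral (f \o g).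
Proof.
move=> df dg; elim: df => // h _ ih; first exact: (dihedral_s ih).
exact: (dihedral_t ih).
Qed.

Lemma dihedral_inv f :
  dihedral f -> exists g, [/\ dihedral g, cancel f g & cancel g f].
Proof.
elim=> [|h _ [g [dg hK gK]]|h _ [g [dg hK gK]]].
- by exists id; split=> //; exact: dihedral_id.
- exists (g \o s); split=> [|z /=|z /=]; last by rewrite gK ssK.
    by apply: dihedral_comp => //; apply: (dihedral_s dihedral_id).
  by rewrite ssK hK.
- exists (g \o t); split=> [|z /=|z /=]; last by rewrite gK ttK.
    by apply: dihedral_comp => //; apply: (dihedral_t dihedral_id).
  by rewrite ttK hK.
Qed.

Lemma rotation_inj : injective u.
Proof. exact: inj_comp (inv_inj ttK) (inv_inj ssK). Qed.

Lemma iter_rotation_inj i : injective (iter i u).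
Proof. by elim: i => [|i ih] x y //= /rotation_inj /ih. Qed.

(** Conjugation by the reflection s inverts the rotation u. *)
Lemma reflect_rotation i z : iter i u (s (iter i u z)) = s z.
Proof.
elim: i z => [//|i ih] z.
by rewrite iterSr iterS {2}/u ssK /u ttK -/u ih.
Qed.

(** Even indices enumerate the rotations u^i, odd ones the reflections u^i s. *)
Definition dihedral_elt k : T -> T := iter k./2 u \o (if odd k then s else id).

Lemma iter_modn n i z : iter n u =1 id -> iter (i %% n) u z = iter i u z.
Proof.
move=> un; rewrite {2}(divn_eq i n) addnC iterD; congr (iter _ _ _).
by elim: (i %/ n)%N => [//|k ih]; rewrite mulSn iterD -ih un.
Qed.

Lemma dihedral_eltP i (b : bool) z :
  dihedral_elt (i.*2 + b) z = iter i u (if b then s z else z).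
Proof.
rewrite /dihedral_elt oddD odd_double halfD odd_double doubleK oddb /=.
by case: b => /=; rewrite addn0.
Qed.

Lemma dihedral_elt_in k : dihedral (dihedral_elt k).
Proof.
have du i : dihedral (iter i u).
  elim: i => [|i ih]; first exact: dihedral_id.
  exact: (dihedral_t (dihedral_s ih)).
apply: dihedral_comp => //; case: odd; last exact: dihedral_id.
exact: (dihedral_s dihedral_id).
Qed.

(** Composing u^i s^b with s on the left gives u^(n-i) s^(1-b), and t = u s. *)
Lemma dihedralE n :
  (0 < n)%N -> iter n u =1 id -> dihedral = dihedral_elt @` `I_n.*2.
Proof.
move=> n0 un; apply/seteqP; split=> [f df|_ [k _ <-]]; last exact: dihedral_elt_in.
suff [i [b fE]] : exists i (b : bool), f =1 dihedral_elt (i.*2 + b).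
  exists ((i %% n).*2 + b)%N => /=.
    move: (ltn_pmod i n0); move: (i %% n)%N => j lj.
    by case: b {fE} => /=; lia.
  apply/funext => z; rewrite dihedral_eltP fE dihedral_eltP.
  exact: iter_modn.
have sE h : (exists i (b : bool), h =1 dihedral_elt (i.*2 + b)) ->
    exists i (b : bool), s \o h =1 dihedral_elt (i.*2 + b).
  case=> i [b hE]; exists (n - i %% n)%N, (~~ b) => z /=.
  apply: (@iter_rotation_inj (i %% n)).
  rewrite hE !dihedral_eltP -iterD subnKC ?(ltnW (ltn_pmod _ _)) // un.
  rewrite -[iter i u _](iter_modn i _ un) reflect_rotation.
  by case: b {hE} => //=; rewrite ssK.
elim: df => {f} [|h _ ih|h _ ih]; first by exists 0%N, false.
  exact: sE.
have [i [b hE]] := sE _ ih; exists i.+1, b => z.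
by rewrite dihedral_eltP iterS -dihedral_eltP -hE /= /u ssK.
Qed.

Hypotheses (sN1 : s <> id) (tN1 : t <> id).

(** If s were a power of u it would commute with u, hence with t, so u^2 = 1
and s would be 1 or u = t s, making s or t trivial. *)
Lemma reflection_not_rotation i : s <> iter i u.
Proof.
move=> sE; have stC z : t (s z) = s (t z).
  have su : s (u (s z)) = u z.
    by rewrite sE -iterS iterSr -sE ssK.
  by have := su; rewrite /u ssK => ->.
have u2 j z : iter j.*2 u z = z.
  by elim: j => //= j ->; rewrite /u -!stC ssK ttK.
have [oi|ei] := boolP (odd i); last first.
  by apply: sN1; apply/funext => z; rewrite sE -[i]odd_double_half (negPf ei) u2.
apply: tN1; apply/funext => z.
have -> : t z = u (s z) by rewrite /u ssK.
rewrite {1}sE -iterS -[in LHS](odd_double_half i) oi add1n -doubleS.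
exact: u2.
Qed.

(** The order of the rotation is the minimal period n, and no rotation is a
reflection, so the 2n enumerated elements are distinct. *)
Lemma card_dihedral n : (0 < n)%N -> iter n u =1 id ->
  (forall k, (0 < k < n)%N -> ~ iter k u =1 id) -> dihedral #= `I_n.*2.
Proof.
move=> n0 un minn; rewrite (dihedralE n0 un); apply: inj_card_eq => j k.
rewrite !inE /= -[j]odd_double_half -[k]odd_double_half ![(odd _ + _)%N]addnC.
set i := j./2; set i' := k./2; move: (odd j) (odd k) => b b' lj lk E.
have {lj} li : (i < n)%N by lia.
have {lk} li' : (i' < n)%N by lia.
have Ez z : iter i u (if b then s z else z) = iter i' u (if b' then s z else z).
  by rewrite -!dihedral_eltP E.
have mixed a a' : (a < n)%N -> (forall z, iter a u (s z) = iter a' u z) -> False.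
  move=> la Eaa; apply: (@reflection_not_rotation (n - a + a')).
  by apply/funext => z; rewrite iterD -Eaa -iterD subnK ?un // ltnW.
have same a a' : (a <= a' < n)%N -> (forall z, iter a u z = iter a' u z) -> a = a'.
  move=> /andP[le_aa la'] Eaa; apply/eqP; rewrite eqn_leq le_aa leqNgt /=.
  apply/negP => lt_aa; apply: (@minn (a' - a)%N); first by lia.
  move=> z; apply: (@iter_rotation_inj a).
  by rewrite -iterD subnKC // Eaa.
have {}same a a' : (a < n)%N -> (a' < n)%N ->
    (forall z, iter a u z = iter a' u z) -> a = a'.
  move=> la la' Eaa; have [le|lt] := leqP a a'; first by apply: same; rewrite ?le.
  by apply/esym/same => [|z]; rewrite ?Eaa // (ltnW lt).
case: b b' Ez {E} => [] [] /= Ez.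
- congr (_.*2 + _)%N; apply: same => // z.
  by have := Ez (s z); rewrite !ssK.
- by case: (mixed i i').
- by case: (mixed i' i).
- by congr (_.*2 + _)%N; apply: same.
Qed.

(** Having 8 elements forces u to have finite order, by pigeonhole on its
powers; that order n then satisfies 2n = 8. *)
Lemma card_dihedral8 :
  dihedral #= `I_8 <-> iter 4 u =1 id /\ ~ iter 2 u =1 id.
Proof.
split=> [c8|[u4 u2]]; last first.
  rewrite (_ : 8 = 4.*2)%N //; apply: card_dihedral => // -[//|[|[|[|k]]]] k4 uk.
  - by apply: u2 => z; rewrite /= -[u z]/(iter 1 u z) !uk.
  - exact: u2.
  - apply: u2 => z; have := u4 z; rewrite -[iter 4 u z]/(u (iter 3 u z)) uk => u1.
    by rewrite /= u1.
  - by [].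
have [n /andP[n0 /asboolP un] minn] :
    {n : nat | (0 < n)%N && `[< iter n u =1 id >] &
       forall m, (0 < m)%N && `[< iter m u =1 id >] -> (n <= m)%N}.
  have exn : exists n, (0 < n)%N && `[< iter n u =1 id >].
    apply: contrapT => noper.
    have iter_inj : {in [set: nat] &, injective (fun i => iter i u)}.
      move=> i j _ _; wlog le_ij : i j / (i <= j)%N => [wl E|E].
        by have [/wl|/ltnW /wl h] := leqP i j; [exact|apply/esym/h].
      apply/eqP; rewrite eqn_leq le_ij leqNgt /=; apply/negP => lt_ij.
      apply: noper; exists (j - i)%N; rewrite subn_gt0 lt_ij /=.
      apply/asboolP => z; apply: (@iter_rotation_inj i).
      by rewrite -iterD subnKC // E.
    apply: infinite_nat.
    have := inj_card_eq iter_inj; rewrite card_eq_sym => /eq_finite_set ->.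
    apply: sub_finite_set (_ : _ `<=` dihedral) _ => [_ [i _ <-]|].
      by have := dihedral_elt_in i.*2; rewrite /dihedral_elt odd_double doubleK.
    by apply/finite_setP; exists 8%N.
  by exists (ex_minn exn); case: ex_minnP.
have {minn} minn k : (0 < k < n)%N -> ~ iter k u =1 id.
  move=> /andP[k0 kn] uk.
  by have := minn k; rewrite k0 /= leqNgt kn; move/(_ (asboolT uk)).
have cn := card_dihedral n0 un minn.
have := card_eq_trans (card_esym cn) c8; move/card_eq_II => n8.
have {n8} n4 : n = 4%N by lia.
rewrite n4 in un minn; split=> // u2.
exact: minn 2 _ u2.
Qed.
End Dihedral.

(** * Rational maps as functions on the open quadrant *)

Lemma numden (S : idomainType) (f : {fraction S}) :
  f = tofrac \n_(repr f) / tofrac \d_(repr f).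
Proof.
have d0 : tofrac \d_(repr f) != 0 by rewrite tofrac_eq0 denom_ratioP.
apply: (canRL (mulfK d0)); rewrite -{1}[f]reprK.
move: (repr f) => r {d0}; unlock tofrac; rewrite -[LHS]FracField.pi_mul.
apply/eqmodP; rewrite /= FracField.equivfE /FracField.mulf.
by rewrite !numden_Ratio ?(mulr1, oner_neq0, denom_ratioP) // mulrC.
Qed.

Section Realization.
Variable R : realFieldType.
Implicit Types (p q : {poly {poly R}}) (f g : ratfun R) (m : ratmap R).

Definition pos (z : R * R) : bool := (0 < z.1) && (0 < z.2).

(** The representation p / q is one whose denominator vanishes nowhere on the
quadrant; an arbitrary representative of f may lack that property. *)
Definition realizes f (h : R * R -> R) : Prop :=
  exists p q, [/\ f = tofrac p / tofrac q,
    forall z, pos z -> q.[z.1, z.2] != 0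
  & forall z, pos z -> h z = p.[z.1, z.2] / q.[z.1, z.2]].

(** A univariate polynomial with infinitely many roots is zero; this is used
for p as a polynomial in x, then for each of its values as one in y. *)
Lemma bipoly_eq0 p : (forall z, pos z -> p.[z.1, z.2] = 0) -> p = 0.
Proof.
have many_roots (S : idomainType) (r : {poly S}) (v : nat -> S) :
    injective v -> (forall n, r.[v n] = 0) -> r = 0.
  move=> vi r0; apply/eqP/negPn/negP => rN0.
  have ra : all (root r) (map v (iota 0 (size r))).
    by apply/allP => _ /mapP [n _ ->]; apply/rootP.
  have := max_poly_roots rN0 ra.
  by rewrite size_map size_iota ltnn map_inj_uniq ?iota_uniq // => /(_ isT).
have ni : injective (fun n => n.+1%:R : R).
  by move=> i j /eqP; rewrite eqr_nat eqSS => /eqP.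
move=> p0; apply: (many_roots _ _ (fun n => (n.+1%:R : R)%:P)).
  by move=> i j /polyC_inj /ni.
move=> i; apply: (many_roots _ _ _ ni) => j.
by apply: (p0 (i.+1%:R, j.+1%:R)); rewrite /pos /= !ltr0Sn.
Qed.

Lemma tofrac_neq0 p :
  (forall z, pos z -> p.[z.1, z.2] != 0) -> tofrac p != 0.
Proof.
move=> p0; rewrite tofrac_eq0; apply/eqP => pE.
by have := p0 (1, 1); rewrite pE !horner0 eqxx /pos /= ltr01 => /(_ isT).
Qed.

Lemma realizes_inj f g h : realizes f h -> realizes g h -> f = g.
Proof.
move=> [p [q [-> q0 hE]]] [p' [q' [-> q0' hE']]].
apply/eqP; rewrite eqr_div ?tofrac_neq0 // -!tofracM tofrac_eq -subr_eq0.
apply/eqP/bipoly_eq0 => z zp; rewrite !hornerE /=.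
have /eqP := hE z zp; rewrite hE' // eqr_div ?q0 ?q0' // => /eqP E.
by rewrite E subrr.
Qed.

Lemma realizes_fun f h h' : realizes f h -> realizes f h' ->
  forall z, pos z -> h z = h' z.
Proof.
move=> [p [q [fE q0 hE]]] [p' [q' [fE' q0' hE']]] z zp.
move: fE'; rewrite fE => /eqP; rewrite eqr_div ?tofrac_neq0 // -!tofracM tofrac_eq.
move=> /eqP /(congr1 (fun r => r.[z.1, z.2])); rewrite !hornerE /= => E.
by rewrite hE // hE' //; apply/eqP; rewrite eqr_div ?q0 ?q0' // E.
Qed.

Lemma realizes_ext f h h' : realizes f h -> (forall z, pos z -> h z = h' z) ->
  realizes f h'.
Proof.
by move=> [p [q [fE q0 hE]]] E; exists p, q; split=> // z zp; rewrite -E // hE.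
Qed.

Lemma realizes_cst c : realizes (cst c) (fun=> c).
Proof.
exists c%:P%:P, 1; rewrite tofrac1 divr1.
by split=> // z _; rewrite !hornerE /= ?oner_neq0 ?divr1.
Qed.

Lemma realizes_X : realizes (ratX R) fst.
Proof.
exists 'X, 1; rewrite tofrac1 divr1.
by split=> // z _; rewrite !hornerE /= ?oner_neq0 ?divr1.
Qed.

Lemma realizes_Y : realizes (ratY R) snd.
Proof.
exists 'Y, 1; rewrite tofrac1 divr1.
by split=> // z _; rewrite !hornerE /= ?oner_neq0 ?divr1.
Qed.

Lemma realizesD f g h k :
  realizes f h -> realizes g k -> realizes (f + g) (fun z => h z + k z).
Proof.
move=> [p [q [-> q0 hE]]] [p' [q' [-> q0' hE']]].
exists (p * q' + p' * q), (q * q'); split.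
- by rewrite tofracD !tofracM addf_div ?tofrac_neq0.
- by move=> z zp; rewrite !hornerE mulf_neq0 ?q0 ?q0'.
- by move=> z zp; rewrite hE // hE' // !(hornerD, hornerM) addf_div ?q0 ?q0'.
Qed.

Lemma realizesM f g h k :
  realizes f h -> realizes g k -> realizes (f * g) (fun z => h z * k z).
Proof.
move=> [p [q [-> q0 hE]]] [p' [q' [-> q0' hE']]].
exists (p * p'), (q * q'); split.
- by rewrite !tofracM mulf_div.
- by move=> z zp; rewrite !hornerE mulf_neq0 ?q0 ?q0'.
- by move=> z zp; rewrite hE // hE' // !hornerM mulf_div.
Qed.

Lemma realizesV f h : realizes f h -> (forall z, pos z -> h z != 0) ->
  realizes f^-1 (fun z => (h z)^-1).
Proof.
move=> [p [q [-> q0 hE]]] h0; exists q, p; split; first by rewrite invf_div.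
  move=> z zp; have := h0 z zp; rewrite hE // mulf_eq0 negb_or.
  by case/andP.
by move=> z zp; rewrite hE // invf_div.
Qed.

Definition mrealizes m (H : R * R -> R * R) : Prop :=
  realizes m.1 (fun z => (H z).1) /\ realizes m.2 (fun z => (H z).2).

(* Declared so that map_poly (map_poly cst) is seen as a ring morphism. *)
HB.instance Definition _ :=
  GRing.RMorphism.copy (@cst R) (@tofrac {poly {poly R}} \o polyC \o polyC).

Lemma eval_atM p q m : eval_at (p * q) m = eval_at p m * eval_at q m.
Proof. by rewrite /eval_at rmorphM !hornerM. Qed.

Lemma eval_atD p q m : eval_at (p + q) m = eval_at p m + eval_at q m.
Proof. by rewrite /eval_at rmorphD !hornerD. Qed.

Lemma realizes_eval_at p m H : mrealizes m H ->
  realizes (eval_at p m) (fun z => p.[(H z).1, (H z).2]).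
Proof.
move=> [m1 m2].
have evalC (r : {poly R}) : realizes (eval_at r%:P m) (fun z => r.[(H z).2]).
  rewrite /eval_at map_polyC hornerC /=.
  elim/poly_ind: r => [|r c ih].
    rewrite rmorph0 horner0 -(rmorph0 (@cst R)).
    by apply: realizes_ext (realizes_cst _) _ => z _; rewrite horner0.
  rewrite rmorphD rmorphM /= map_polyX map_polyC !hornerE.
  apply: realizes_ext (realizesD (realizesM ih m2) (realizes_cst c)) _ => z _.
  by rewrite !hornerE.
elim/poly_ind: p => [|p r ih].
  by apply: realizes_ext (evalC 0) _ => z _; rewrite !horner0.
rewrite eval_atD eval_atM.
have -> : eval_at 'X m = m.1 by rewrite /eval_at map_polyX !hornerE.
apply: realizes_ext (realizesD (realizesM ih m1) (evalC r)) _ => z _.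
by rewrite !hornerE.
Qed.

(** Surjectivity makes the realized map dominant: only the zero polynomial
vanishes on its image. *)
Definition quadrant_onto (H : R * R -> R * R) : Prop :=
  (forall z, pos z -> pos (H z)) /\
  (forall z, pos z -> exists2 z', pos z' & H z' = z).

Lemma eval_at_neq0 p m H :
  mrealizes m H -> quadrant_onto H -> p != 0 -> eval_at p m != 0.
Proof.
move=> mH [Hp Hs]; apply: contra_neq => e0; apply: bipoly_eq0 => z zp.
have [z' z'p <-] := Hs z zp.
have := realizes_eval_at p mH; rewrite e0 -(rmorph0 (@cst R)) => r0.
by have := realizes_fun r0 (realizes_cst 0) z'p.
Qed.

(** For a dominant map, the value of a substitution does not depend on the
fraction chosen to represent f. *)
Lemma substE p q m H : mrealizes m H -> quadrant_onto H -> q != 0 ->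
  subst (tofrac p / tofrac q) m = eval_at p m / eval_at q m.
Proof.
move=> mH Ho q0; rewrite /subst; set f := _ / _.
apply/eqP; rewrite eqr_div ?(eval_at_neq0 mH Ho) ?denom_ratioP // -!eval_atM.
apply/eqP; congr (eval_at _ m); apply/eqP; rewrite -tofrac_eq !tofracM.
by rewrite -eqr_div ?tofrac_eq0 ?denom_ratioP // -numden.
Qed.

Lemma realizes_subst f h m H : realizes f h -> mrealizes m H ->
  quadrant_onto H -> realizes (subst f m) (h \o H).
Proof.
move=> [p [q [-> q0 hE]]] mH Ho.
have qN0 : q != 0 by rewrite -tofrac_eq0 tofrac_neq0.
rewrite (substE p mH Ho qN0); have Hp := Ho.1.
have eq0 z : pos z -> q.[(H z).1, (H z).2] != 0 by move=> zp; exact: q0 (Hp _ zp).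
apply: realizes_ext (realizesM (realizes_eval_at p mH)
  (realizesV (realizes_eval_at q mH) eq0)) _ => z zp /=.
by rewrite hE // Hp.
Qed.

Lemma mrealizes_id : mrealizes (ratmap_id R) id.
Proof. by split; [exact: realizes_X | exact: realizes_Y]. Qed.

Lemma mrealizes_comp m n G H : mrealizes m G -> mrealizes n H ->
  quadrant_onto H -> mrealizes (ratmap_comp m n) (G \o H).
Proof.
move=> [m1 m2] nH Ho; split; first exact: (realizes_subst m1 nH Ho).
exact: (realizes_subst m2 nH Ho).
Qed.

Lemma mrealizes_inj m n H : mrealizes m H -> mrealizes n H -> m = n.
Proof.
case: m n => [m1 m2] [n1 n2] [/= a b] [/= c d].
by rewrite (realizes_inj a c) (realizes_inj b d).
Qed.

Lemma mrealizes_fun m G H : mrealizes m G -> mrealizes m H ->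
  forall z, pos z -> G z = H z.
Proof.
move=> [a b] [c d] z zp; rewrite [G z]surjective_pairing [H z]surjective_pairing.
by rewrite (realizes_fun a c) // (realizes_fun b d).
Qed.

(** An arbitrary f with f o m = k agrees with any realized f' that takes the
expected values, because the points G z fill the quadrant.  This identifies
rational inverses, about which nothing is known beforehand. *)
Lemma subst_cancel f f' k h m G H : mrealizes m G -> quadrant_onto G ->
  (forall z, pos z -> H (G z) = z) ->
  realizes k h -> realizes f' (h \o H) -> subst f m = k -> f = f'.
Proof.
move=> mG Go HK kh [p [q [-> q0 hE]]] E.
have d0 := denom_ratioP (repr f).
have qN0 := tofrac_neq0 q0.
rewrite [f]numden; apply/eqP.
rewrite eqr_div ?tofrac_eq0 ?d0 -?(tofrac_eq0 q) // -!tofracM tofrac_eq.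
rewrite -subr_eq0; apply/eqP/bipoly_eq0 => z zp.
have [z' z'p <-] := Go.2 z zp; rewrite !(hornerD, hornerM, hornerN).
have eN : eval_at \n_(repr f) m = k * eval_at \d_(repr f) m.
  by rewrite -E; exact: esym (divfK (eval_at_neq0 mG Go d0) _).
have := realizes_eval_at \n_(repr f) mG; rewrite eN => rN.
have rD := realizesM kh (realizes_eval_at \d_(repr f) mG).
rewrite -(realizes_fun rD rN) //.
have G'p := Go.1 _ z'p; have := hE _ G'p; rewrite /= HK // => ->.
by rewrite mulrAC divfK ?subrr // q0.
Qed.

Lemma mrealizes_cancel n n' m G H : mrealizes m G -> quadrant_onto G ->
  (forall z, pos z -> H (G z) = z) -> mrealizes n' H ->
  ratmap_comp n m = ratmap_id R -> n = n'.
Proof.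
case: n n' => [n1 n2] [n1' n2'] mG Go HK [/= r1 r2] [E1 E2].
congr pair; first exact: (subst_cancel mG Go HK realizes_X r1 E1).
exact: (subst_cancel mG Go HK realizes_Y r2 E2).
Qed.

(* Two involutions of the plane that preserve the quadrant and are trivial
   outside of it, realized by the rational maps f1 and f2. *)
Variables (s t : R * R -> R * R) (f1 f2 : ratmap R).
Hypotheses (ssK : involutive s) (ttK : involutive t).
Hypotheses (sp : forall z, pos (s z) = pos z) (tp : forall z, pos (t z) = pos z).
Hypotheses (s_out : forall z, ~~ pos z -> s z = z).
Hypotheses (t_out : forall z, ~~ pos z -> t z = z).
Hypotheses (f1s : mrealizes f1 s) (f2t : mrealizes f2 t).
Let D := dihedral s t.

Lemma dihedral_pos (f : R * R -> R * R) z : D f -> pos (f z) = pos z.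
Proof. by move=> Df; elim: Df => //= h _ ih; rewrite ?sp ?tp. Qed.

Lemma dihedral_out (f : R * R -> R * R) z : D f -> ~~ pos z -> f z = z.
Proof. by move=> Df zp; elim: Df => //= h _ ->; rewrite ?s_out ?t_out. Qed.

Lemma dihedral_onto (f : R * R -> R * R) : D f -> quadrant_onto f.
Proof.
move=> Df; split=> z zp; first by rewrite dihedral_pos.
have [g [Dg fK gK]] := dihedral_inv ssK ttK Df.
by exists (g z); rewrite ?dihedral_pos.
Qed.

Lemma dihedral_generated (f : R * R -> R * R) :
  D f -> exists2 m, generated [set f1; f2] m & mrealizes m f.
Proof.
elim=> {f} [|f Df [m gm mf]|f Df [m gm mf]].
- by exists (ratmap_id R); [exact: generated_id | exact: mrealizes_id].
- exists (ratmap_comp f1 m).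
    by apply: generated_comp => //; apply: generated_gen; left.
  exact: mrealizes_comp (dihedral_onto Df).
- exists (ratmap_comp f2 m).
    by apply: generated_comp => //; apply: generated_gen; right.
  exact: mrealizes_comp (dihedral_onto Df).
Qed.

Lemma generated_dihedral m :
  generated [set f1; f2] m -> exists2 f, D f & mrealizes m f.
Proof.
have Ds : D s := dihedral_s (dihedral_id s t).
have Dt : D t := dihedral_t (dihedral_id s t).
elim=> {m} [m [->|->]||m n _ [f Df mf] _ [g Dg ng]|m n _ [f Df mf] [_ nm]].
- by exists s.
- by exists t.
- by exists id; [exact: dihedral_id | exact: mrealizes_id].
- exists (f \o g); first exact: dihedral_comp.
  exact: mrealizes_comp (dihedral_onto Dg).
- have [g [Dg fK gK]] := dihedral_inv ssK ttK Df.
  have [m' _ m'g] := dihedral_generated Dg; exists g => //.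
  by rewrite (mrealizes_cancel mf (dihedral_onto Df) (fun z _ => fK z) m'g nm).
Qed.

(** Realization is a bijection between the group generated by f1 and f2 and the
group generated by s and t. *)
Lemma card_generated : generated [set f1; f2] #= D.
Proof.
have ch (f : R * R -> R * R) :
    {m | D f -> generated [set f1; f2] m /\ mrealizes m f}.
  apply: cid; have [Df|nDf] := pselect (D f); last by exists f1 => /nDf.
  by have [m gm mf] := dihedral_generated Df; exists m.
pose F (f : R * R -> R * R) := sval (ch f).
have FP (f : R * R -> R * R) : D f -> _ := svalP (ch f).
have -> : generated [set f1; f2] = F @` D.
  apply/seteqP; split=> [m /[dup] gm /generated_dihedral [f Df mf]|_ [f Df <-]].
    by exists f => //; apply: mrealizes_inj (FP f Df).2 mf.
  exact: (FP f Df).1.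
apply: inj_card_eq => f g; rewrite !inE => Df Dg E.
apply/funext => z; have [zp|zp] := boolP (pos z).
  apply: mrealizes_fun zp; first exact: (FP f Df).2.
  by rewrite [sval _]E; exact: (FP g Dg).2.
by rewrite !(dihedral_out _ zp).
Qed.
End Realization.

(** * The two involutions of a walk and its symmetries *)

Section Walk.
Variable R : realFieldType.
Implicit Types (P Q : 'M[R]_3) (x y : R).

Definition quad (a b c : R) x : R := a * x ^+ 2 + b * x + c.

(** The quotient C1 / A1, with numerator and denominator multiplied by y. *)
Definition alpha P y : R :=
  quad (weight P (-1) 1) (weight P (-1) 0) (weight P (-1) (-1)) y /
  quad (weight P 1 1) (weight P 1 0) (weight P 1 (-1)) y.

(** The quotient C2 / A2: transposing the weights exchanges x and y. *)
Definition beta P x : R := alpha P^T x.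

Lemma weight_tr P i j : weight P^T i j = weight P j i.
Proof. by rewrite /weight mxE. Qed.

Lemma rev_step_index (i : int) : i \in steps ->
  rev_ord (step_index i) = step_index (- i).
Proof.
by rewrite !inE => /or3P [] /eqP ->; apply/val_inj; rewrite /= !inordK.
Qed.

Definition mirror P : 'M[R]_3 := \matrix_(i, j) P (rev_ord i) j.

Lemma mirrorK : involutive mirror.
Proof. by move=> P; apply/matrixP => i j; rewrite !mxE rev_ordK. Qed.

Lemma weight_mirror P (i j : int) : i \in steps ->
  weight (mirror P) i j = weight P (- i) j.
Proof. by move=> si; rewrite /weight mxE rev_step_index. Qed.

Lemma step_index_surj (k : 'I_3) : exists2 i, i \in steps & step_index i = k.
Proof.
case: k => [[|[|[|//]]] lk]; [exists 1|exists 0|exists (-1)] => //;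
  by apply/val_inj; rewrite /= inordK.
Qed.

Lemma matrix_weight_inj P Q :
  {in steps &, forall i j, weight P i j = weight Q i j} -> P = Q.
Proof.
move=> E; apply/matrixP => k l.
have [i si <-] := step_index_surj k; have [j sj <-] := step_index_surj l.
exact: E.
Qed.

Definition nonneg_weights P := forall i j, 0 <= P i j.

Definition row_mass P i := weight P i 1 + weight P i 0 + weight P i (-1).

(** For nonnegative weights, positive mass of the rows 1 and -1 and of the
columns 1 and -1 says that A1, C1, A2 and C2 are nonzero. *)
Definition proper_walk P :=
  [/\ nonneg_weights P, 0 < row_mass P 1 /\ 0 < row_mass P (-1)
    & 0 < row_mass P^T 1 /\ 0 < row_mass P^T (-1)].

Lemma proper_walk_tr P : proper_walk P -> proper_walk P^T.
Proof. by move=> [p0 r c]; split; rewrite ?trmxK // => i j; rewrite mxE. Qed.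

Lemma proper_walk_mirror P : proper_walk P -> proper_walk (mirror P).
Proof.
move=> [p0 [r1 r2] [c1 c2]]; split; first by move=> i j; rewrite mxE.
  by rewrite /row_mass !weight_mirror.
rewrite /row_mass !weight_tr !weight_mirror // oppr0 !opprK.
by move: c1 c2; rewrite /row_mass !weight_tr; split; lra.
Qed.

Lemma quad_gt0 (a b c x : R) : 0 <= a -> 0 <= b -> 0 <= c -> 0 < a + b + c ->
  0 < x -> 0 < quad a b c x.
Proof.
move=> a0 b0 c0 s x0; rewrite /quad.
have ax := mulr_ge0 a0 (ltW (exprn_gt0 2 x0)); have bx := mulr_ge0 b0 (ltW x0).
have [ap|an] := ltP 0 a; first by have := mulr_gt0 ap (exprn_gt0 2 x0); lra.
have [bp|bn] := ltP 0 b; first by have := mulr_gt0 bp x0; lra.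
lra.
Qed.

Lemma alpha_gt0 P y : proper_walk P -> 0 < y -> 0 < alpha P y.
Proof.
move=> [p0 [r1 r2] _] y0.
by rewrite divr_gt0 // quad_gt0 //; apply: p0.
Qed.

Lemma beta_gt0 P x : proper_walk P -> 0 < x -> 0 < beta P x.
Proof. by move=> /proper_walk_tr; exact: alpha_gt0. Qed.

(** Extended by the identity outside the quadrant, so that the flips are
involutions of the whole plane and functional extensionality applies. *)
Definition flipx P (z : R * R) : R * R :=
  if pos z then (alpha P z.2 / z.1, z.2) else z.
Definition flipy P (z : R * R) : R * R :=
  if pos z then (z.1, beta P z.1 / z.2) else z.

Definition period P n :=
  forall z, pos z -> iter n (fun z => flipy P (flipx P z)) z = z.

Section Group.
Variable P : 'M[R]_3.
Hypothesis ndP : proper_walk P.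

Lemma pos_flipx z : pos (flipx P z) = pos z.
Proof.
rewrite /flipx; case: ifP => // zp; have [z1 z2] := andP zp.
by rewrite /pos /= z2 divr_gt0 ?alpha_gt0.
Qed.

Lemma pos_flipy z : pos (flipy P z) = pos z.
Proof.
rewrite /flipy; case: ifP => // zp; have [z1 z2] := andP zp.
by rewrite /pos /= z1 divr_gt0 ?beta_gt0.
Qed.

Lemma flipx_inv : involutive (flipx P).
Proof.
move=> z; have [zp|zp] := boolP (pos z); last by rewrite /flipx !(negPf zp).
rewrite {1}/flipx pos_flipx zp /flipx zp /=; have [z1 z2] := andP zp.
rewrite [RHS]surjective_pairing; congr pair.
have a0 := alpha_gt0 ndP z2.
by rewrite invf_div mulrCA divff ?mulr1 ?gt_eqF.
Qed.

Lemma flipy_inv : involutive (flipy P).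
Proof.
move=> z; have [zp|zp] := boolP (pos z); last by rewrite /flipy !(negPf zp).
rewrite {1}/flipy pos_flipy zp /flipy zp /=; have [z1 z2] := andP zp.
rewrite [RHS]surjective_pairing; congr pair.
have a0 := beta_gt0 ndP z1.
by rewrite invf_div mulrCA divff ?mulr1 ?gt_eqF.
Qed.

Lemma flipx_id : flipx P <> id.
Proof.
move=> E; have := f_equal (fun f => f (1, 1)) E.
have := f_equal (fun f => f (2, 1)) E.
rewrite /flipx /pos /= ltr01 ltr0n /= => -[e2] [e1].
by move: e1 e2; rewrite invr1 mulr1 => ->; lra.
Qed.

Lemma flipy_id : flipy P <> id.
Proof.
move=> E; have := f_equal (fun f => f (1, 1)) E.
have := f_equal (fun f => f (1, 2)) E.
rewrite /flipy /pos /= ltr01 ltr0n /= => -[e2] [e1].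
by move: e1 e2; rewrite invr1 mulr1 => ->; lra.
Qed.

Lemma realizes_laurent (w : int -> R) (f : ratfun R) h :
  realizes f h -> (forall z, pos z -> 0 < h z) ->
  realizes (\sum_(j <- steps) cst (w j) * f ^ j)
    (fun z => quad (w 1) (w 0) (w (-1)) (h z) / h z).
Proof.
move=> fh hp; have h0 z : pos z -> h z != 0 by move=> zp; rewrite gt_eqF ?hp.
rewrite /steps !big_cons big_nil addr0 exprN1 expr0z expr1z mulr1.
apply: realizes_ext (realizesD (realizesM (realizes_cst (w (-1)))
  (realizesV fh h0)) (realizesD (realizes_cst (w 0))
  (realizesM (realizes_cst (w 1)) fh))) _ => z zp.
by rewrite /quad; field; rewrite h0.
Qed.

Lemma realizes_ratio f f' g h h' k : realizes f h -> realizes f' h' ->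
  realizes g k -> (forall z : R * R, pos z -> h' z != 0 /\ k z != 0) ->
  realizes (f / (g * f')) (fun z => h z / (k z * h' z)).
Proof.
move=> fh fh' gk hk; apply: realizesM => //; apply: realizesV.
  exact: realizesM.
by move=> z zp; have [a b] := hk z zp; rewrite mulf_neq0.
Qed.

Lemma phi1_realizes : mrealizes (phi1 P) (flipx P).
Proof.
split=> /=; last first.
  by apply: realizes_ext (realizes_Y R) _ => z zp; rewrite /flipx zp.
have Yp (z : R * R) : pos z -> 0 < z.2 by case/andP.
have q0 z : pos z -> 0 < quad (weight P 1 1) (weight P 1 0) (weight P 1 (-1)) z.2.
  move=> /Yp z2; have [p0 [r1 r2] _] := ndP.
  by apply: quad_gt0 => //; apply: p0.
have rA := realizes_laurent (weight P 1) (realizes_Y R) Yp.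
have rC := realizes_laurent (weight P (-1)) (realizes_Y R) Yp.
apply: realizes_ext (realizes_ratio rC rA (realizes_X R) _) _ => z zp.
  by rewrite mulf_neq0 ?invr_neq0 ?gt_eqF ?Yp ?q0 //; case/andP: zp.
have [z1 z2] := andP zp; rewrite /flipx zp /= /alpha.
by field; rewrite !gt_eqF ?q0.
Qed.

Lemma phi2_realizes : mrealizes (phi2 P) (flipy P).
Proof.
split=> /=.
  by apply: realizes_ext (realizes_X R) _ => z zp; rewrite /flipy zp.
have Xp (z : R * R) : pos z -> 0 < z.1 by case/andP.
have q0 z : pos z ->
    0 < quad (weight P^T 1 1) (weight P^T 1 0) (weight P^T 1 (-1)) z.1.
  move=> /Xp z1; have [p0 _ [r1 r2]] := ndP.
  by apply: quad_gt0 => //; rewrite weight_tr; apply: p0.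
have rA := realizes_laurent (weight P ^~ 1) (realizes_X R) Xp.
have rC := realizes_laurent (weight P ^~ (-1)) (realizes_X R) Xp.
apply: realizes_ext (realizes_ratio rC rA (realizes_Y R) _) _ => z zp.
  have := q0 z zp; rewrite !weight_tr => q0z.
  by rewrite mulf_neq0 ?invr_neq0 ?gt_eqF ?Xp //; case/andP: zp.
have [z1 z2] := andP zp; have := q0 z zp.
rewrite /flipy zp /= /beta /alpha !weight_tr => q0z.
by field; rewrite !gt_eqF.
Qed.

Lemma iter_out n z : ~~ pos z -> iter n (fun z => flipy P (flipx P z)) z = z.
Proof.
by move=> zp; elim: n => //= n ->; rewrite /flipx (negPf zp) /flipy (negPf zp).
Qed.

Lemma periodE n : period P n <-> iter n (fun z => flipy P (flipx P z)) =1 id.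
Proof.
split=> [pn z|pn z _ //]; have [zp|zp] := boolP (pos z); first exact: pn.
exact: iter_out.
Qed.

Lemma card_walk_group : walk_group P #= `I_8 <-> period P 4 /\ ~ period P 2.
Proof.
have cg : walk_group P #= dihedral (flipx P) (flipy P).
  apply: card_generated phi1_realizes phi2_realizes.
  - exact: flipx_inv.
  - exact: flipy_inv.
  - exact: pos_flipx.
  - exact: pos_flipy.
  - by move=> z /negPf zp; rewrite /flipx zp.
  - by move=> z /negPf zp; rewrite /flipy zp.
have c8 := card_dihedral8 flipx_inv flipy_inv flipx_id flipy_id.
rewrite !periodE -c8; split=> c.
  exact: card_eq_trans (card_esym cg) c.
exact: card_eq_trans cg c.
Qed.
End Group.

(** Exchanging x and y conjugates the rotation of the transposed walk to the
inverse rotation, up to one more conjugation by flipx. *)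
Lemma period_tr P n : proper_walk P -> period P n -> period P^T n.
Proof.
move=> ndP pn; pose sw (z : R * R) := (z.2, z.1).
have psw z : pos (sw z) = pos z by rewrite /pos andbC.
have sx z : flipx P^T (sw z) = sw (flipy P z).
  by rewrite /flipx psw /flipy; case: ifP.
have sy z : flipy P^T (sw z) = sw (flipx P z).
  by rewrite /flipx /flipy psw /beta trmxK; case: ifP.
have conj m z : iter m (fun z => flipy P^T (flipx P^T z)) (sw z) =
    sw (flipx P (iter m (fun z => flipy P (flipx P z)) (flipx P z))).
  elim: m => [|m ih] /=; first by rewrite (flipx_inv ndP).
  by rewrite ih sx sy.
move=> z zp; have -> : z = sw (sw z) by case: z {zp}.
by rewrite conj pn ?(flipx_inv ndP) // pos_flipx ?psw.
Qed.

(** Reversing the rows amounts to the change of variable x -> 1/x. *)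
Lemma period_mirror P n : proper_walk P -> period P n -> period (mirror P) n.
Proof.
move=> ndP pn; pose inv (z : R * R) := (z.1^-1, z.2).
have pinv z : pos (inv z) = pos z by rewrite /pos /= invr_gt0.
have aE y : alpha (mirror P) y = (alpha P y)^-1.
  by rewrite /alpha !weight_mirror ?opprK // invf_div.
have bE x : 0 < x -> beta (mirror P) x^-1 = beta P x.
  move=> x0; rewrite /beta /alpha !weight_tr !weight_mirror // oppr0 !opprK.
  have E a b c : quad a b c x^-1 = quad c b a x / x ^+ 2.
    by rewrite /quad; field; rewrite gt_eqF.
  rewrite !E -mulf_div divff ?mulr1 //.
  by rewrite invr_neq0 // expf_neq0 // gt_eqF.
have sx z : flipx (mirror P) (inv z) = inv (flipx P z).
  rewrite /flipx pinv; case: ifP => // /andP[z1 z2].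
  by rewrite /inv /= aE (invfM (alpha _ _)) .
have sy z : flipy (mirror P) (inv z) = inv (flipy P z).
  by rewrite /flipy pinv; case: ifP => // /andP[z1 z2]; rewrite /inv /= bE.
have conj m z : iter m (fun z => flipy (mirror P) (flipx (mirror P) z)) (inv z) =
    inv (iter m (fun z => flipy P (flipx P z)) z).
  by elim: m => //= m ->; rewrite sx sy.
move=> z zp; have -> : z = inv (inv z) by rewrite /inv invrK; case: z {zp}.
by rewrite conj pn ?pinv.
Qed.

Lemma sym_colsE Q : \matrix_(i, j) Q i (rev_ord j) = (mirror Q^T)^T.
Proof. by apply/matrixP => i j; rewrite !mxE. Qed.

Lemma symmetric_period P Q n : proper_walk P -> symmetric_to P Q ->
  proper_walk Q /\ (period P n <-> period Q n).
Proof.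
have tr S : proper_walk S -> proper_walk S^T /\ (period S n <-> period S^T n).
  move=> nd; have nd' := proper_walk_tr nd; split=> //.
  split; first exact: period_tr.
  by move/(period_tr nd'); rewrite trmxK.
have mi S : proper_walk S ->
    proper_walk (mirror S) /\ (period S n <-> period (mirror S) n).
  move=> nd; have nd' := proper_walk_mirror nd; split=> //.
  split; first exact: period_mirror.
  by move/(period_mirror nd'); rewrite mirrorK.
move=> ndP; elim=> [|S _ [nd E]|S _ [nd E]|S _ [nd E]] //.
- by have [nd' E'] := mi _ nd; rewrite E E'.
- rewrite sym_colsE; have [nd1 E1] := tr _ nd; have [nd2 E2] := mi _ nd1.
  by have [nd3 E3] := tr _ nd2; rewrite E E1 E2 E3.
- by have [nd' E'] := tr _ nd; rewrite E E'.
Qed.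

End Walk.

(** * Leading terms at 0 *)

Section Leading.
Variable R : realType.
Implicit Types (P : 'M[R]_3) (g h : R -> R) (l m : R * int).

(** The pair (c, k) stands for the equivalent c t^k of g at 0 from the right; a
null coefficient codes the zero function, whatever the exponent, so that
vanishing weights need no separate treatment. *)
Definition leading g l : Prop :=
  [\/ l.1 = 0 /\ (forall t, 0 < t -> g t = 0)
    | 0 < l.1 /\ (g t * t ^ (- l.2) @[t --> 0^'+] --> l.1)].

(** Addition of leading terms; equal exponents add their coefficients, which is
sound for nonnegative coefficients since these cannot cancel. *)
Definition ladd l m : R * int :=
  if l.1 == 0 then m else if m.1 == 0 then l else
  if l.2 < m.2 then l else if m.2 < l.2 then m else (l.1 + m.1, l.2).
Definition lmul l m : R * int := (l.1 * m.1, l.2 + m.2).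
Definition linv l : R * int := (l.1^-1, - l.2).

Lemma near_right_pos (Q : R -> Prop) :
  (forall t, 0 < t -> Q t) -> \forall t \near 0^'+, Q t.
Proof.
by move=> h; near=> t; apply: h; near: t; exact: nbhs_right_gt.
Unshelve. all: by end_near. Qed.

Lemma cvg_right_ext g h (c : R) : (forall t, 0 < t -> g t = h t) ->
  (g t @[t --> 0^'+] --> c) -> h t @[t --> 0^'+] --> c.
Proof.
move=> gh; apply: cvg_trans; apply: near_eq_cvg.
exact: near_right_pos.
Qed.

Lemma leading_ext g h l :
  (forall t, 0 < t -> g t = h t) -> leading g l -> leading h l.
Proof.
move=> gh [[l0 g0]|[lp gl]]; [left|right]; split=> //.
  by move=> t t0; rewrite -gh ?g0.
by apply: cvg_right_ext gl => t t0; rewrite gh.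
Qed.

Lemma leading_cst c : 0 <= c -> leading (fun=> c) (c, 0).
Proof.
rewrite le_eqVlt => /predU1P[<-|c0]; [by left|right; split => //=].
by rewrite oppr0; apply: cvg_right_ext (cvg_cst c) => t _; rewrite expr0z mulr1.
Qed.

Lemma leading_X (u : int) : leading (fun t => t ^ u) (1, u).
Proof.
right; split=> //=.
apply: (@cvg_right_ext (fun=> 1) _ 1) (cvg_cst _) => t t0.
by rewrite -expfzDr ?gt_eqF // subrr.
Qed.

Lemma leadingM g h l m :
  leading g l -> leading h m -> leading (fun t => g t * h t) (lmul l m).
Proof.
move=> [[l0 g0]|[lp gl]].
  by left; rewrite /= l0 mul0r; split=> // t t0; rewrite g0 ?mul0r.
move=> [[m0 h0]|[mp hm]].
  by left; rewrite /= m0 mulr0; split=> // t t0; rewrite h0 ?mulr0.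
right; split=> /=; first exact: mulr_gt0.
apply: cvg_right_ext (cvgM gl hm) => t t0 /=.
by rewrite opprD expfzDr ?gt_eqF // mulrACA.
Qed.

Lemma leadingV g l : 0 < l.1 -> leading g l -> leading (fun t => (g t)^-1) (linv l).
Proof.
move=> lp [[l0]|[_ gl]]; first by rewrite l0 ltxx in lp.
right; split=> /=; first by rewrite invr_gt0.
apply: cvg_right_ext (cvgV _ gl) => [t t0 /=|]; last by rewrite gt_eqF.
by rewrite opprK invfM invr_expz opprK.
Qed.

Lemma cvg_expz (k : int) : 0 < k -> (t ^ k : R) @[t --> 0^'+] --> 0.
Proof.
have cid : (t : R) @[t --> 0^'+] --> (0 : R) by exact: cvg_within.
case: k => // -[//|k] _; elim: k => [|k ih]; first exact: cid.
have c0 : (t * t ^ k.+1 : R) @[t --> 0^'+] --> (0 * 0 : R) by exact: cvgM cid ih.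
rewrite mulr0 in c0.
apply: cvg_right_ext c0 => t _ /=.
by rewrite -exprSz.
Qed.

Lemma leadingD g h l m :
  leading g l -> leading h m -> leading (fun t => g t + h t) (ladd l m).
Proof.
move=> gl hm; rewrite /ladd; case: eqP => l0.
  case: gl => [[_ g0]|[lp _]]; last by rewrite l0 ltxx in lp.
  by apply: leading_ext hm => t t0; rewrite g0 ?add0r.
case: eqP => m0.
  case: hm => [[_ h0]|[mp _]]; last by rewrite m0 ltxx in mp.
  by apply: leading_ext gl => t t0; rewrite h0 ?addr0.
case: gl hm => [[//]|[lp gl]] [[//]|[mp hm]].
have dom (f f' : R -> R) k k' : 0 < k.1 -> k.2 < k'.2 ->
    (f t * t ^ (- k.2) @[t --> 0^'+] --> (k.1 : R)) ->
    (f' t * t ^ (- k'.2) @[t --> 0^'+] --> (k'.1 : R)) ->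
    leading (fun t => f t + f' t) k.
  move=> kp lt fk fk'; right; split=> //.
  rewrite -[k.1]addr0 -[X in _ + X](mulr0 k'.1).
  have ek : 0 < k'.2 - k.2 by rewrite subr_gt0.
  apply: cvg_right_ext (cvgD fk (cvgM fk' (cvg_expz ek))) => t t0 /=.
  rewrite -mulrA -expfzDr ?gt_eqF // addrA addNr add0r mulrDl //.
case: ltgtP => lm.
- exact: dom lm gl hm.
- by apply: leading_ext (dom h g m l mp lm hm gl) => t _; rewrite addrC.
- right; split=> /=; first exact: addr_gt0.
  by apply: cvg_right_ext (cvgD gl hm) => t t0 /=; rewrite lm mulrDl.
Qed.

Lemma leading_uniq g l m :
  0 < l.1 -> 0 < m.1 -> leading g l -> leading g m -> l = m.
Proof.
move=> lp mp [[l0]|[_ gl]]; first by rewrite l0 ltxx in lp.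
move=> [[m0]|[_ gm]]; first by rewrite m0 ltxx in mp.
have no (k k' : R * int) : 0 < k.1 -> k.2 < k'.2 ->
    (g t * t ^ (- k.2) @[t --> 0^'+] --> (k.1 : R)) ->
    (g t * t ^ (- k'.2) @[t --> 0^'+] --> (k'.1 : R)) -> False.
  move=> kp lt fk fk'.
  have ek : 0 < k'.2 - k.2 by rewrite subr_gt0.
  have c0 : (g t * t ^ (- k'.2) * t ^ (k'.2 - k.2) : R) @[t --> 0^'+]
      --> (k'.1 * 0 : R) by exact: cvgM fk' (cvg_expz ek).
  rewrite mulr0 in c0.
  have ck : (g t * t ^ (- k.2) @[t --> 0^'+] --> (0 : R)).
    apply: cvg_right_ext c0 => t t0 /=.
    by rewrite -mulrA -expfzDr ?gt_eqF // addrA addNr add0r.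
  by move: kp; rewrite (cvg_unique _ fk ck) ?ltxx.
have e2 : l.2 = m.2.
  case: (ltgtP l.2 m.2) => // lm; first by case: (no l m).
  by case: (no m l).
have e1 : l.1 = m.1.
  by rewrite -e2 in gm; exact: cvg_unique gl gm.
by rewrite [l]surjective_pairing [m]surjective_pairing e1 e2.
Qed.

Definition lquad a b c l : R * int :=
  ladd (ladd (lmul (a, 0) (lmul l l)) (lmul (b, 0) l)) (c, 0).

Lemma leading_quad a b c g l : 0 <= a -> 0 <= b -> 0 <= c ->
  leading g l -> leading (fun t => quad a b c (g t)) (lquad a b c l).
Proof.
move=> a0 b0 c0 gl; apply: leading_ext (leadingD (leadingD
  (leadingM (leading_cst a0) (leadingM gl gl))
  (leadingM (leading_cst b0) gl)) (leading_cst c0)) => t _ /=.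
by rewrite /quad expr2.
Qed.

Definition lalpha P l : R * int :=
  lmul (lquad (weight P (-1) 1) (weight P (-1) 0) (weight P (-1) (-1)) l)
    (linv (lquad (weight P 1 1) (weight P 1 0) (weight P 1 (-1)) l)).
Definition lbeta P l : R * int := lalpha P^T l.

Lemma ladd_ge0 l m : 0 <= l.1 -> 0 <= m.1 -> 0 <= (ladd l m).1.
Proof. by move=> l0 m0; rewrite /ladd; do 4?case: ifP => //; rewrite addr_ge0. Qed.

Lemma ladd_gt0 l m : 0 <= l.1 -> 0 <= m.1 -> 0 < l.1 + m.1 -> 0 < (ladd l m).1.
Proof.
move=> l0 m0; rewrite /ladd; case: eqP => [->|/eqP lN0]; first by rewrite add0r.
case: eqP => [->|/eqP mN0]; first by rewrite addr0.
by move=> ?; do 2?case: ifP => //= _; rewrite lt_def ?lN0 ?mN0.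
Qed.

Lemma lquad_gt0 a b c l : 0 <= a -> 0 <= b -> 0 <= c -> 0 < a + b + c ->
  0 < l.1 -> 0 < (lquad a b c l).1.
Proof.
move=> a0 b0 c0 s l0.
have a0' : 0 <= (lmul (a, 0) (lmul l l)).1 by rewrite !mulr_ge0 // ltW.
have b0' : 0 <= (lmul (b, 0) l).1 by rewrite !mulr_ge0 // ltW.
have [cp|cn] := ltP 0 c.
  by apply: ladd_gt0 => //=; rewrite ?ladd_ge0 // ltr_wpDl // ladd_ge0.
have c00 : c = 0 by apply/eqP; rewrite eq_le cn c0.
apply: ladd_gt0; rewrite ?ladd_ge0 //= ?c00 // addr0.
apply: ladd_gt0 => //=.
move: s; rewrite c00 addr0 => s; have [ap|an] := ltP 0 a.
  by rewrite ltr_wpDr // !mulr_gt0.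
by rewrite ltr_wpDl // mulr_gt0 //; lra.
Qed.

Lemma lalpha_gt0 P l : proper_walk P -> 0 < l.1 -> 0 < (lalpha P l).1.
Proof.
move=> [p0 [r1 r2] _] l0.
rewrite mulr_gt0 ?invr_gt0 // lquad_gt0 //; apply: p0.
Qed.

Lemma leading_alpha P g l : proper_walk P -> 0 < l.1 -> leading g l ->
  leading (fun t => alpha P (g t)) (lalpha P l).
Proof.
move=> [p0 [r1 r2] _] l0 gl; apply: leadingM.
  by apply: leading_quad; rewrite ?p0.
apply: leadingV; first by apply: lquad_gt0 => //; apply: p0.
by apply: leading_quad; rewrite ?p0.
Qed.

Definition lflipx P (z : (R * int) * (R * int)) :=
  (lmul (lalpha P z.2) (linv z.1), z.2).
Definition lflipy P (z : (R * int) * (R * int)) :=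
  (z.1, lmul (lbeta P z.1) (linv z.2)).

Definition curve_leading (z : R -> R * R) w : Prop :=
  [/\ forall t, 0 < t -> pos (z t), 0 < w.1.1 /\ 0 < w.2.1,
      leading (fun t => (z t).1) w.1 & leading (fun t => (z t).2) w.2].

Lemma curve_flipx P z w : proper_walk P ->
  curve_leading z w -> curve_leading (flipx P \o z) (lflipx P w).
Proof.
move=> nd [zp [w1 w2] l1 l2]; split=> [t t0||/=|/=].
- by rewrite /= pos_flipx ?zp.
- by split; rewrite //= mulr_gt0 ?invr_gt0 ?lalpha_gt0.
- apply: leading_ext (leadingM (leading_alpha nd w2 l2) (leadingV w1 l1)) => t t0.
  by rewrite /flipx zp.
- by apply: leading_ext l2 => t t0; rewrite /flipx zp.
Qed.

Lemma curve_flipy P z w : proper_walk P ->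
  curve_leading z w -> curve_leading (flipy P \o z) (lflipy P w).
Proof.
move=> nd [zp [w1 w2] l1 l2]; have nd' := proper_walk_tr nd.
split=> [t t0||/=|/=].
- by rewrite /= pos_flipy ?zp.
- by split; rewrite //= mulr_gt0 ?invr_gt0 ?lalpha_gt0.
- by apply: leading_ext l1 => t t0; rewrite /flipy zp.
- apply: leading_ext (leadingM (leading_alpha nd' w1 l1) (leadingV w2 l2)) => t t0.
  by rewrite /flipy zp.
Qed.

(** The n-th iterate fixes the curve (a t^p, b t^q), and leading terms are
unique. *)
Lemma leading_period P n w : proper_walk P -> period P n ->
  0 < w.1.1 -> 0 < w.2.1 -> iter n (fun w => lflipy P (lflipx P w)) w = w.
Proof.
move=> nd pn w1 w2; pose z t : R * R := (w.1.1 * t ^ w.1.2, w.2.1 * t ^ w.2.2).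
have lz (l : R * int) : 0 < l.1 -> leading (fun t => l.1 * t ^ l.2) l.
  move=> l0; have := leadingM (leading_cst (ltW l0)) (leading_X l.2).
  by rewrite /lmul /= mulr1 add0r -surjective_pairing.
have cz : curve_leading z w.
  split=> //; [|exact: lz|exact: lz].
  by move=> t t0; rewrite /pos /= !mulr_gt0 ?exprz_gt0.
have cn : curve_leading (fun t => iter n (fun z => flipy P (flipx P z)) (z t))
    (iter n (fun w => lflipy P (lflipx P w)) w).
  by elim: (n) => // k ih /=; apply/curve_flipy/curve_flipx.
case: cn cz => _ [a b] c d [zp _ e f].
rewrite [LHS]surjective_pairing [RHS]surjective_pairing; congr pair.
  apply: (leading_uniq a w1 c).
  by apply: leading_ext e => t t0; rewrite pn ?zp.
apply: (leading_uniq b w2 d).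
by apply: leading_ext f => t t0; rewrite pn ?zp.
Qed.

End Leading.

(** * Tropical classification of the supports *)

(** The exponents of leading terms form the min-plus semiring, with None as the
exponent of zero. *)
Definition tmin (x y : option int) : option int :=
  if x isn't Some i then y else if y isn't Some j then x else
  Some (if j < i then j else i).

Definition tquad (a b c : bool) (v : int) : int :=
  odflt 0 (tmin (tmin (if a then Some (v + v) else None)
                      (if b then Some v else None))
                (if c then Some 0 else None)).

(** Functions of a support, given as eight flags that tell which weights are
nonzero, in the order (1,1), (1,0), (1,-1), (0,1), (0,-1), (-1,1), (-1,0),
(-1,-1); in flag names, m stands for -1. *)
Definition table (T : Type) :=
  bool -> bool -> bool -> bool -> bool -> bool -> bool -> bool -> T.

(** The map induced on exponents by one rotation. *)
Definition tstep (b11 b10 b1m b01 b0m bm1 bm0 bmm : bool) (z : int * int) :=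
  let u := tquad bm1 bm0 bmm z.2 - tquad b11 b10 b1m z.2 - z.1 in
  (u, tquad b1m b0m bmm u - tquad b11 b01 bm1 u - z.2).

Definition full_support (b11 b10 b1m b01 b0m bm1 bm0 bmm : bool) :=
  [&& [|| b11, b10 | b1m], [|| bm1, bm0 | bmm],
      [|| b11, b01 | bm1] & [|| b1m, b0m | bmm]].

Definition monomial_support (b11 b10 b1m b01 b0m bm1 bm0 bmm : bool) :=
  [&& ~~ b11, b10, b1m, ~~ b01, ~~ b0m, bm1, bm0 & ~~ bmm].

Definition skew_support (b11 b10 b1m b01 b0m bm1 bm0 bmm : bool) :=
  [&& ~~ b11, b10, b1m, ~~ b01, b0m, bm1, ~~ bm0 & ~~ bmm].

Definition tripod_support (b11 b10 b1m b01 b0m bm1 bm0 bmm : bool) :=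
  [&& b11, b10 == bm0, ~~ b1m, b0m, bm1 & ~~ bmm].

(** Two nonzero quadratics with coefficient supports a b c and a' b' c', by
decreasing degree, have equal lowest degrees and equal highest degrees. *)
Definition same_span (a b c a' b' c' : bool) :=
  [&& [|| a, b | c], [|| a', b' | c'],
   (if c then c' else ~~ c' && (b == b')) & (if a then a' else ~~ a' && (b == b'))].

(** alpha and beta have finite nonzero limits at 0 and at infinity. *)
Definition balanced_support (b11 b10 b1m b01 b0m bm1 bm0 bmm : bool) :=
  same_span b11 b10 b1m bm1 bm0 bmm && same_span b11 b01 bm1 b1m b0m bmm.

Definition tr_table T (f : table T) : table T :=
  fun b11 b10 b1m b01 b0m bm1 bm0 bmm => f b11 b01 bm1 b10 bm0 b1m b0m bmm.
Definition mirror_table T (f : table T) : table T :=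
  fun b11 b10 b1m b01 b0m bm1 bm0 bmm => f bm1 bm0 bmm b01 b0m b11 b10 b1m.

Definition some_symmetry (f : table bool) : table bool :=
  fun b11 b10 b1m b01 b0m bm1 bm0 bmm =>
  let ap g := g b11 b10 b1m b01 b0m bm1 bm0 bmm in
  [|| ap f, ap (tr_table f), ap (mirror_table f), ap (mirror_table (tr_table f)),
      ap (tr_table (mirror_table f)), ap (tr_table (mirror_table (tr_table f))),
      ap (mirror_table (tr_table (mirror_table f))) |
      ap (mirror_table (tr_table (mirror_table (tr_table f))))].

(** The orbit of the single exponent vector (-3, -2) discriminates the supports;
the proof runs through all of them. *)
Lemma tropical_classification b11 b10 b1m b01 b0m bm1 bm0 bmm :
  let ap T (f : table T) := f b11 b10 b1m b01 b0m bm1 bm0 bmm in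
  ap _ full_support -> iter 4 (ap _ tstep) (-3, -2) = (-3, -2) ->
  [|| ap _ (some_symmetry monomial_support), ap _ (some_symmetry skew_support),
      ap _ (some_symmetry tripod_support) | ap _ balanced_support].
Proof.
by case: b11 b10 b1m b01 b0m bm1 bm0 bmm => [] [] [] [] [] [] [] [];
   vm_compute.
Qed.

Section Classification.
Variable R : realType.
Implicit Types (P Q : 'M[R]_3) (l m : R * int).

Definition texp l : option int := if l.1 == 0 then None else Some l.2.

Lemma texp_add l m : 0 <= l.1 -> 0 <= m.1 ->
  texp (ladd l m) = tmin (texp l) (texp m).
Proof.
move=> l0 m0; rewrite /ladd /tmin {2 3}/texp.
case: eqP => lN0 //; case: eqP => mN0; first by rewrite /texp; case: eqP.
case: (ltgtP l.2 m.2) => lm; rewrite /texp /=.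
- by case: eqP.
- by case: eqP.
by rewrite gt_eqF // addr_gt0 // lt_def ?l0 ?m0 andbT; apply/eqP.
Qed.

Lemma tropical_quad (a b c : R) l : 0 <= a -> 0 <= b -> 0 <= c ->
  0 < a + b + c -> 0 < l.1 ->
  (lquad a b c l).2 = tquad (a != 0) (b != 0) (c != 0) l.2.
Proof.
move=> a0 b0 c0 s l0.
have q0 := lquad_gt0 a0 b0 c0 s l0.
have -> : (lquad a b c l).2 = odflt 0 (texp (lquad a b c l)).
  by rewrite /texp gt_eqF.
have a0' : 0 <= (lmul (a, 0) (lmul l l)).1 by rewrite !mulr_ge0 // ltW.
have b0' : 0 <= (lmul (b, 0) l).1 by rewrite !mulr_ge0 // ltW.
rewrite !texp_add ?ladd_ge0 // /tquad /texp /= !mulf_eq0 (gt_eqF l0) !orbF !add0r.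
by do 3?case: eqP.
Qed.

Definition on_support P T (f : table T) : T :=
  f (weight P 1 1 != 0) (weight P 1 0 != 0) (weight P 1 (-1) != 0)
    (weight P 0 1 != 0) (weight P 0 (-1) != 0)
    (weight P (-1) 1 != 0) (weight P (-1) 0 != 0) (weight P (-1) (-1) != 0).

Lemma proper_walk_support P : proper_walk P -> on_support P full_support.
Proof.
move=> [p0 [r1 r2] [c1 c2]].
have nz a b c : 0 < (a + b + c : R) -> [|| a != 0, b != 0 | c != 0].
  move=> s; apply: contraTT s; rewrite !negb_or !negbK.
  case/and3P=> /eqP-> /eqP-> /eqP->.
  by rewrite !addr0 ltxx.
move: c1 c2; rewrite /row_mass !weight_tr => c1 c2.
by apply/and4P; split; apply: nz.
Qed.

Lemma tropical_step P w : proper_walk P -> 0 < w.1.1 -> 0 < w.2.1 ->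
  let w' := lflipy P (lflipx P w) in
  [/\ 0 < w'.1.1, 0 < w'.2.1
    & (w'.1.2, w'.2.2) = on_support P tstep (w.1.2, w.2.2)].
Proof.
move=> nd w1 w2 w'; have nd' := proper_walk_tr nd.
have aE S l : proper_walk S -> 0 < l.1 -> (lalpha S l).2 =
    tquad (weight S (-1) 1 != 0) (weight S (-1) 0 != 0)
      (weight S (-1) (-1) != 0) l.2
    - tquad (weight S 1 1 != 0) (weight S 1 0 != 0) (weight S 1 (-1) != 0) l.2.
  by move=> [p0 [r1 r2] _] l0; rewrite /= !tropical_quad //; apply: p0.
have x0 : 0 < w'.1.1 by apply: mulr_gt0; rewrite ?invr_gt0 ?lalpha_gt0.
split=> //; first by apply: mulr_gt0; rewrite ?invr_gt0 ?lalpha_gt0.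
have -> : w'.2.2 = (lalpha P^T w'.1).2 - w.2.2 by [].
rewrite aE // !weight_tr.
by have -> : w'.1.2 = (lalpha P w.2).2 - w.1.2 by []; rewrite aE.
Qed.

Lemma tropical_period P n : proper_walk P -> period P n ->
  forall z, iter n (on_support P tstep) z = z.
Proof.
move=> nd pn [u v]; have pw := leading_period nd pn (w := ((1, u), (1, v))).
have := pw ltr01 ltr01; set F := fun w => _ => E.
have [_ _ <-] : [/\ 0 < (iter n F ((1, u), (1, v))).1.1,
    0 < (iter n F ((1, u), (1, v))).2.1
  & ((iter n F ((1, u), (1, v))).1.2, (iter n F ((1, u), (1, v))).2.2)
    = iter n (on_support P tstep) (u, v)].
  elim: n {E pn pw} => [|k [a b E]]; first by rewrite /= ltr01.
  by rewrite !iterS -E; apply: tropical_step.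
by rewrite E.
Qed.

Lemma on_support_tr P T (f : table T) :
  on_support P^T f = on_support P (tr_table f).
Proof. by rewrite /on_support !weight_tr. Qed.

Lemma on_support_mirror P T (f : table T) :
  on_support (mirror P) f = on_support P (mirror_table f).
Proof. by rewrite /on_support !weight_mirror // oppr0 opprK. Qed.

Lemma on_support_some_symmetry P (f : table bool) :
  on_support P (some_symmetry f) ->
  exists2 Q, symmetric_to P Q & on_support Q f.
Proof.
have trS Q : symmetric_to P Q -> symmetric_to P Q^T := @sym_tr R P Q.
have miS Q : symmetric_to P Q -> symmetric_to P (mirror Q) := @sym_rows R P Q.
have h : symmetric_to P P := sym_refl P.
case/or4P => [f0|f0|f0|/or4P[f0|f0|f0|/orP[f0|f0]]].
- by exists P.
- by exists P^T; [exact: trS | rewrite on_support_tr].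
- by exists (mirror P); [exact: miS | rewrite on_support_mirror].
- by exists (mirror P)^T; [exact/trS/miS | rewrite on_support_tr on_support_mirror].
- by exists (mirror P^T); [exact/miS/trS | rewrite on_support_mirror on_support_tr].
- exists (mirror P^T)^T; first exact/trS/miS/trS.
  by rewrite on_support_tr on_support_mirror on_support_tr.
- exists (mirror (mirror P)^T); first exact/miS/trS/miS.
  by rewrite on_support_mirror on_support_tr on_support_mirror.
- exists (mirror (mirror P)^T)^T; first exact/trS/miS/trS/miS.
  by rewrite on_support_tr on_support_mirror on_support_tr on_support_mirror.
Qed.

Lemma period_support P : proper_walk P -> period P 4 ->
  on_support P balanced_support \/
  exists2 Q, symmetric_to P Q &
    [|| on_support Q monomial_support, on_support Q skew_support
      | on_support Q tripod_support].
Proof.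
move=> nd p4.
have := tropical_classification (proper_walk_support nd) (tropical_period nd p4 _).
case/or4P => [f0|f0|f0|f0]; last by left.
- by right; have [Q PQ fQ] := on_support_some_symmetry f0; exists Q; rewrite ?fQ.
- right; have [Q PQ fQ] := on_support_some_symmetry f0.
  by exists Q; rewrite ?fQ ?orbT.
- right; have [Q PQ fQ] := on_support_some_symmetry f0.
  by exists Q; rewrite ?fQ ?orbT.
Qed.
End Classification.

(** * Leading orbits of the four families of supports *)

Ltac nonzero := solve [do ?[apply/andP; split];
  do ?[assumption | exact: oner_neq0 | apply: mulf_neq0 | apply: expf_neq0
      | rewrite invr_eq0] | done].

(** Closes the side conditions of one explicit step of an orbit. *)
Ltac close_step := first [done | nonzero | by field; nonzero].

Section LeadingOrbits.
Variable R : realType.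
Implicit Types (P Q : 'M[R]_3) (l m : R * int) (x y : R) (u v : int).

Lemma ladd_ltl l m : l.1 != 0 -> l.2 < m.2 -> ladd l m = l.
Proof. by move=> l0 lm; rewrite /ladd (negPf l0) lm; case: ifP. Qed.

Lemma ladd_ltr l m : m.1 != 0 -> m.2 < l.2 -> ladd l m = m.
Proof.
move=> m0 ml; rewrite /ladd (negPf m0) ml ltNge (ltW ml) /=.
by case: ifP.
Qed.

Lemma ladd0l l m : l.1 = 0 -> ladd l m = m.
Proof. by rewrite /ladd => ->; rewrite eqxx. Qed.

Lemma ladd0r l m : l.1 != 0 -> m.1 = 0 -> ladd l m = l.
Proof. by rewrite /ladd => /negPf-> ->; rewrite eqxx. Qed.

Lemma lquad_top a b c y v : a != 0 -> y != 0 -> v < 0 ->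
  lquad a b c (y, v) = (a * y ^+ 2, v + v).
Proof.
move=> a0 y0 v0; have ay : a * y ^+ 2 != 0 by rewrite mulf_neq0 ?expf_neq0.
by rewrite /lquad /lmul /= !add0r -expr2 !ladd_ltl //=; lia.
Qed.

Lemma lquad_bottom a b c y v : c != 0 -> 0 < v ->
  lquad a b c (y, v) = (c, 0).
Proof.
move=> c0 v0; rewrite /lquad /lmul /= !add0r; apply: ladd_ltr => //=.
by rewrite /ladd; do 4?case: ifP => _ //=; lia.
Qed.

Lemma lquad_linear_bottom a b y v : b != 0 -> y != 0 -> 0 < v ->
  lquad a b 0 (y, v) = (b * y, v).
Proof.
move=> b0 y0 v0; have by0 : b * y != 0 by rewrite mulf_neq0.
rewrite /lquad /lmul /= !add0r [ladd (_, v + v) _]ladd_ltr //=; last by lia.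
exact: ladd0r.
Qed.

Lemma lquad_linear_top b c y v : b != 0 -> y != 0 -> v < 0 ->
  lquad 0 b c (y, v) = (b * y, v).
Proof.
move=> b0 y0 v0; have by0 : b * y != 0 by rewrite mulf_neq0.
by rewrite /lquad /lmul /= !add0r [ladd (_, v + v) _]ladd0l ?ladd_ltl //= mul0r.
Qed.

Lemma lquad_square a y v : a != 0 -> y != 0 ->
  lquad a 0 0 (y, v) = (a * y ^+ 2, v + v).
Proof.
move=> a0 y0; have ay : a * y ^+ 2 != 0 by rewrite mulf_neq0 ?expf_neq0.
by rewrite /lquad /lmul /= !add0r mul0r -expr2 !ladd0r.
Qed.

Lemma lquad_const c y v : lquad 0 0 c (y, v) = (c, 0).
Proof. by rewrite /lquad /lmul /ladd /= !mul0r eqxx /= eqxx. Qed.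

(** A function with a finite nonzero limit keeps all three terms of quad. *)
Lemma lquad_unit a b c y : lquad a b c (y, 0) = (quad a b c y, 0).
Proof.
have E x x' : ladd (x, 0) (x', 0) = (x + x' : R, 0 : int).
  rewrite /ladd /=; case: eqP => [->|_]; first by rewrite add0r.
  by case: eqP => [->|_] //; rewrite addr0.
by rewrite /lquad /lmul /= !E /quad expr2.
Qed.

Lemma lalpha_unit P y : lalpha P (y, 0) = (alpha P y, 0).
Proof. by rewrite /lalpha !lquad_unit /lmul /= oppr0. Qed.

Lemma lstep_to P x u y v X k x' u' Y j y' v' :
  lalpha P (y, v) = (X, k) -> X / x = x' -> k - u = u' ->
  lbeta P (x', u') = (Y, j) -> Y / y = y' -> j - v = v' ->
  lflipy P (lflipx P ((x, u), (y, v))) = ((x', u'), (y', v')).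
Proof.
move=> aE ex eu bE <- <-.
rewrite /lflipx aE (_ : lmul (X, k) _ = (x', u')); last by rewrite -ex -eu.
by rewrite /lflipy bE.
Qed.

(** Write p, q, r, s for p_{1,-1}, p_{10}, p_{-1,1}, p_{-1,0}.  Then beta is the
monomial (p/r) x^2, while alpha is equivalent to (s/p) y at 0 and to (r/q) y at
infinity.  Both regimes occur along the orbit of (t, t), and
the fourth point has coefficient (a/b)^2 with a = s/p, b = r/q. *)
Lemma monomial_support_product P :
  proper_walk P -> on_support P monomial_support -> period P 4 ->
  weight P 1 0 * weight P (-1) 0 = weight P 1 (-1) * weight P (-1) 1.
Proof.
move=> nd; rewrite /on_support => /and5P[/negPn/eqP w11 q0 p0 /negPn/eqP w01].
move=> /and4P[/negPn/eqP w0m r0 s0 /negPn/eqP wmm] p4.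
set q := weight P 1 0 in q0 *; set p := weight P 1 (-1) in p0 *.
set r := weight P (-1) 1 in r0 *; set s := weight P (-1) 0 in s0 *.
have w_ge0 i j : 0 <= weight P i j by case: nd => [h _ _]; apply: h.
have [pp qp] : 0 < p /\ 0 < q by rewrite !lt_def p0 q0 !w_ge0.
have [rp sp] : 0 < r /\ 0 < s by rewrite !lt_def r0 s0 !w_ge0.
have aB y v : y != 0 -> 0 < v -> lalpha P (y, v) = (s / p * y, v).
  move=> y0 v0; rewrite /lalpha w11 wmm -/s -/p lquad_linear_bottom //.
  by rewrite lquad_bottom // /lmul /= oppr0 addr0 mulrAC.
have aT y v : y != 0 -> v < 0 -> lalpha P (y, v) = (r / q * y, v).
  move=> y0 v0; rewrite /lalpha w11 wmm -/r -/q -/s lquad_top //.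
  rewrite lquad_linear_top // /lmul /= addrK; congr pair.
  by field; rewrite y0 q0.
have bE x u : x != 0 -> lbeta P (x, u) = (p / r * x ^+ 2, u + u).
  move=> x0; rewrite /lbeta /lalpha !weight_tr w11 wmm w0m w01 -/r -/p.
  by rewrite lquad_square // lquad_const /lmul /= oppr0 addr0 mulrAC.
suff AB : s / p = r / q.
  by apply: (mulIf (invr_neq0 p0)); rewrite -mulrA AB; field; rewrite p0 q0.
have [] : [/\ 0 < s / p, 0 < r / q & 0 < p / r] by rewrite !divr_gt0.
move: (s / p) (r / q) (p / r) aB aT bE => a b c aB aT bE ap bp cp.
have [a0 b0 c0] : [/\ a != 0, b != 0 & c != 0] by rewrite !gt_eqF.
have := leading_period nd p4 (w := ((1 : R, 1 : int), (1 : R, 1 : int)))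
  ltr01 ltr01.
set z0 := (X in iter 4 _ X); set F := fun w => _.
have s1 : F z0 = ((a, 0), (c * a ^+ 2, -1)).
  apply: (lstep_to (aB _ _ _ _)) (bE _ _ _) _ _; close_step.
have s2 : F ((a, 0), (c * a ^+ 2, -1)) =
    ((b * c * a, -1), (c ^+ 2 * b ^+ 2, -1)).
  apply: (lstep_to (aT _ _ _ _)) (bE _ _ _) _ _; close_step.
have s3 : F ((b * c * a, -1), (c ^+ 2 * b ^+ 2, -1)) =
    ((c * b ^+ 2 / a, 0), (c * b ^+ 2 / a ^+ 2, 1)).
  apply: (lstep_to (aT _ _ _ _)) (bE _ _ _) _ _; close_step.
have s4 : F ((c * b ^+ 2 / a, 0), (c * b ^+ 2 / a ^+ 2, 1)) =
    ((1, 1), (a ^+ 2 / b ^+ 2, 1)).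
  apply: (lstep_to (aB _ _ _ _)) (bE _ _ _) _ _; close_step.
rewrite !iterS s1 s2 s3 s4 => -[/eqP ab].
apply/eqP; rewrite -(@eqrXn2 _ 2) ?ltW //.
by rewrite -[eqbRHS]mul1r -(can2_eq (divfK _) (mulfK _)) ?expf_neq0.
Qed.

(** Write p, q, r, s for p_{1,-1}, p_{10}, p_{-1,1}, p_{0,-1}.  The orbit of
(t, 1) returns to an abscissa equivalent to t only if s^2 q^2 = r p^3.  Rescaling x by s/p and y by p/q then reduces the walk to
alpha(Y) = Y^2/(1 + Y) and beta(X) = X (1 + X), for which the rotation sends
(49/69, 14/9) in two steps to (1, 1) and in four to (9/14, 69/49). *)
Lemma skew_support_no_period4 P :
  proper_walk P -> on_support P skew_support -> ~ period P 4.
Proof.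
move=> nd; rewrite /on_support => /and5P[/negPn/eqP w11 q0 p0 /negPn/eqP w01].
move=> /and4P[s0 r0 /negPn/eqP wm0 /negPn/eqP wmm] p4.
set q := weight P 1 0 in q0 *; set p := weight P 1 (-1) in p0 *.
set r := weight P (-1) 1 in r0 *; set s := weight P 0 (-1) in s0 *.
have w_ge0 i j : 0 <= weight P i j by case: nd => [h _ _]; apply: h.
have [pp qp] : 0 < p /\ 0 < q by rewrite !lt_def p0 q0 !w_ge0.
have [rp sp] : 0 < r /\ 0 < s by rewrite !lt_def r0 s0 !w_ge0.
have aB y v : y != 0 -> 0 < v -> lalpha P (y, v) = (r / p * y ^+ 2, v + v).
  move=> y0 v0; rewrite /lalpha w11 wm0 wmm -/r -/p -/q lquad_square //.
  by rewrite lquad_bottom // /lmul /= oppr0 addr0 mulrAC.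
have aT y v : y != 0 -> v < 0 -> lalpha P (y, v) = (r / q * y, v).
  move=> y0 v0; rewrite /lalpha w11 wmm wm0 -/r -/q -/p lquad_square //.
  rewrite lquad_linear_top // /lmul /= addrK; congr pair.
  by field; rewrite y0 q0.
have bB x u : x != 0 -> 0 < u -> lbeta P (x, u) = (s / r * x, u).
  move=> x0 u0; rewrite /lbeta /lalpha !weight_tr w11 wmm w01 -/r -/p -/s.
  by rewrite lquad_const lquad_linear_bottom // /lmul /= oppr0 addr0 mulrAC.
have bT x u : x != 0 -> u < 0 -> lbeta P (x, u) = (p / r * x ^+ 2, u + u).
  move=> x0 u0; rewrite /lbeta /lalpha !weight_tr w11 wmm w01 -/r -/p -/s.
  by rewrite lquad_const lquad_top // /lmul /= oppr0 addr0 mulrAC.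
have alphaE y : alpha P y = r * y ^+ 2 / (q * y + p).
  by rewrite /alpha /quad w11 wmm wm0 -/r -/q -/p; congr (_ / _); ring.
have betaE x : beta P x = (p * x ^+ 2 + s * x) / r.
  rewrite /beta /alpha /quad !weight_tr w11 wmm w01 -/r -/p -/s.
  by congr (_ / _); ring.
have pq0 : p + q != 0 by rewrite gt_eqF ?addr_gt0.
have := leading_period nd p4 (w := ((1 : R, 1 : int), (1 : R, 0 : int)))
  ltr01 ltr01.
set F := fun w => _; set z0 := (X in iter 4 _ X).
have s1 : F z0 = ((r / (p + q), -1), (p * r / (p + q) ^+ 2, -2)).
  apply: (lstep_to (lalpha_unit P _)) (bT _ _ _ _) _ _; rewrite ?alphaE; close_step.
have s2 : F ((r / (p + q), -1), (p * r / (p + q) ^+ 2, -2)) =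
    ((p * r / (q * (p + q)), -1), (p ^+ 2 / q ^+ 2, 0)).
  apply: (lstep_to (aT _ _ _ _)) (bT _ _ _ _) _ _; close_step.
have aK : alpha P (p ^+ 2 / q ^+ 2) = r * p ^+ 3 / (q ^+ 3 * (p + q)).
  rewrite alphaE (_ : q * _ + p = p * (p + q) / q); last by (field; nonzero).
  by field; nonzero.
have s3 : F ((p * r / (q * (p + q)), -1), (p ^+ 2 / q ^+ 2, 0)) =
    ((p ^+ 2 / q ^+ 2, 1), (s / r, 1)).
  apply: (lstep_to (lalpha_unit P _)) (bB _ _ _ _) _ _; rewrite ?aK; close_step.
have s4 : (F ((p ^+ 2 / q ^+ 2, 1), (s / r, 1))).1 =
    (s ^+ 2 * q ^+ 2 / (r * p ^+ 3), 1).
  rewrite /F /lflipx /lflipy aB //=; try nonzero.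
  by congr pair; rewrite /=; field; nonzero.
rewrite !iterS s1 s2 s3 => /(congr1 fst); rewrite s4 => -[rE].
have {}rE : r = s ^+ 2 * q ^+ 2 / p ^+ 3.
  apply: (mulfI (invr_neq0 r0)); rewrite mulVf // -[LHS]rE; by (field; nonzero).
have aS (Y : R) : 1 + Y != 0 ->
    alpha P (p / q * Y) = (s / p) ^+ 2 * (Y ^+ 2 / (1 + Y)).
  move=> Y1; rewrite alphaE rE (_ : q * _ + p = p * (1 + Y)); last first.
    by field; nonzero.
  by field; nonzero.
have bS (X : R) : beta P (s / p * X) = (p / q) ^+ 2 * (X * (1 + X)).
  by rewrite betaE rE; field; nonzero.
have step (X Y X' Y' : R) : 0 < X -> 0 < Y ->
    X' = Y ^+ 2 / (1 + Y) / X -> Y' = X' * (1 + X') / Y ->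
    flipy P (flipx P (s / p * X, p / q * Y)) = (s / p * X', p / q * Y').
  move=> X0 Y0 EX EY; have Y1 : 1 + Y != 0 by rewrite gt_eqF // ltr_wpDl.
  have X'0 : 0 < X' by rewrite EX !divr_gt0 ?exprn_gt0 // ltr_wpDl.
  have [X_neq0 Y_neq0] : X != 0 /\ Y != 0 by rewrite !gt_eqF.
  have scaled (k : R) Z : 0 < k -> 0 < Z -> 0 < k * Z by exact: mulr_gt0.
  have [sp0 pq_gt0] : 0 < s / p /\ 0 < p / q by rewrite !divr_gt0.
  rewrite /flipx (_ : pos _) /=; last by apply/andP; split; exact: scaled.
  rewrite aS // (_ : _ / (s / p * X) = s / p * X'); last first.
    by rewrite EX; field; nonzero.
  rewrite /flipy (_ : pos _) /=; last by apply/andP; split; exact: scaled.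
  by rewrite bS EY; congr pair; field; nonzero.
(* The orbit of (1, 1), followed two steps backwards and two steps forwards;
   this keeps the fractions small. *)
have pos1 : (0 < 1 :> R) := ltr01.
have posq (i j : nat) : 0 < (i.+1%:R / j.+1%:R : R) by rewrite divr_gt0.
have f1 := step (49 / 69) (14 / 9) (4 / 3) 2 (posq _ _) (posq _ _).
have f2 := step (4 / 3) 2 1 1 (posq _ _) (ltr0Sn _ _).
have f3 := step 1 1 (1 / 2) (3 / 4) pos1 pos1.
have f4 := step (1 / 2) (3 / 4) (9 / 14) (69 / 49) (posq 0 _)%N (posq _ _).
have zp : pos (s / p * (49 / 69), p / q * (14 / 9)).
  by apply/andP; split; apply: mulr_gt0; rewrite ?divr_gt0.
have := p4 _ zp; rewrite !iterS /= f1 ?f2 ?f3 ?f4; try by field.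
case=> /(mulfI (mulf_neq0 s0 (invr_neq0 p0))) /eqP + _.
rewrite eqr_div ?pnatr_eq0 // -!natrM eqr_nat.
by [].
Qed.

(** If alpha is a constant a, u^2 fixes x and multiplies y by the positive
factor beta(x)/beta(a/x), whose square is 1 as soon as u^4 = 1. *)
Lemma constant_alpha_period2 P a :
  proper_walk P -> (forall y, 0 < y -> alpha P y = a) ->
  period P 4 -> period P 2.
Proof.
move=> nd aE p4.
have a0 : 0 < a by rewrite -(aE 1 ltr01) alpha_gt0.
pose r x := beta P x / beta P (a / x).
have r0 x : 0 < x -> 0 < r x by move=> x0; rewrite divr_gt0 ?beta_gt0 ?divr_gt0.
have F1 x y : 0 < x -> 0 < y ->
    flipy P (flipx P (x, y)) = (a / x, beta P (a / x) / y).
  move=> x0 y0; rewrite /flipx (_ : pos _) /=; last by rewrite /pos /= x0.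
  by rewrite aE // /flipy (_ : pos _) //= /pos /= divr_gt0.
have F2 x y : 0 < x -> 0 < y ->
    flipy P (flipx P (flipy P (flipx P (x, y)))) = (x, r x * y).
  move=> x0 y0; have ax0 : 0 < a / x by rewrite divr_gt0.
  have b0 := beta_gt0 nd ax0.
  rewrite F1 // F1 //; last by rewrite divr_gt0.
  rewrite (_ : a / (a / x) = x); last by field; rewrite !gt_eqF.
  by congr pair; rewrite /r; field; rewrite !gt_eqF.
move=> [x y] /andP[/= x0 y0]; rewrite F2 //.
have := p4 (x, y); rewrite /pos /= x0 y0 => /(_ isT).
have ry : 0 < r x * y := mulr_gt0 (r0 _ x0) y0.
rewrite F2 // F2 // => -[E].
suff -> : r x = 1 by rewrite mul1r.
apply/eqP; rewrite -(@eqrXn2 _ 2) ?ltW ?r0 // expr1n expr2.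
by apply/eqP/(mulIf (lt0r_neq0 y0)); rewrite -mulrA E mul1r.
Qed.

(** alpha tends to some k > 0 at 0, and beta behaves like x at 0 and like 1/x at
infinity.  The orbit of (t, b) closes only if alpha(b)^2 = k^2, so alpha is the
constant k. *)
Lemma tripod_support_period2 P : proper_walk P -> on_support P tripod_support ->
  period P 4 -> period P 2.
Proof.
move=> nd; rewrite /on_support => /and5P[a0 /eqP mE /negPn/eqP w1m s0].
move=> /andP[c0 /negPn/eqP wmm] p4.
set a := weight P 1 1 in a0 *; set c := weight P (-1) 1 in c0 *.
set s := weight P 0 (-1) in s0 *.
set m := weight P 1 0 in mE *; set m' := weight P (-1) 0 in mE *.
have w_ge0 i j : 0 <= weight P i j by case: nd => [h _ _]; apply: h.
have [ap cp] : 0 < a /\ 0 < c by rewrite !lt_def a0 c0 !w_ge0.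
have sp : 0 < s by rewrite lt_def s0 w_ge0.
have [k kp aB] : exists2 k, 0 < k &
    forall y v, y != 0 -> 0 < v -> lalpha P (y, v) = (k, 0).
  have [m0|mN0] := eqVneq m 0.
    exists (c / a); first by rewrite divr_gt0.
    move=> y v y0 v0; have m'0 : m' = 0.
      by apply/eqP; move: mE; rewrite m0 eqxx /=; case: eqP.
    rewrite /lalpha w1m wmm -/m' -/m -/a -/c m0 m'0 !lquad_square // /lmul /= subrr.
    by congr pair; field; nonzero.
  have m'N0 : m' != 0 by rewrite -mE.
  exists (m' / m).
    by rewrite divr_gt0 // lt_def w_ge0 ?mN0 ?m'N0.
  move=> y v y0 v0.
  rewrite /lalpha w1m wmm -/m' -/m !lquad_linear_bottom // /lmul /= subrr.
  by congr pair; field; nonzero.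
have bB x u : x != 0 -> 0 < u -> lbeta P (x, u) = (s / c * x, u).
  move=> x0 u0; rewrite /lbeta /lalpha !weight_tr w1m wmm -/c -/s.
  by rewrite lquad_linear_bottom // lquad_bottom // /lmul /= oppr0 addr0 mulrAC.
have bT x u : x != 0 -> u < 0 -> lbeta P (x, u) = (s / a / x, - u).
  move=> x0 u0; rewrite /lbeta /lalpha !weight_tr w1m wmm -/a -/s.
  rewrite lquad_linear_top // lquad_top // /lmul /=.
  by congr pair; [field; nonzero | lia].
have k0 : k != 0 by rewrite gt_eqF.
have aN0 y : 0 < y -> alpha P y != 0 by move=> y0; rewrite gt_eqF ?alpha_gt0.
apply: (@constant_alpha_period2 P k) => // b b0.
have bN0 : b != 0 by rewrite gt_eqF.
have := leading_period nd p4 (w := ((1 : R, 1 : int), (b, 0 : int))) ltr01 b0.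
set F := fun w => _; set z0 := (X in iter 4 _ X).
have := aN0 _ b0; set A := alpha P b => A0.
have s1 : F z0 = ((A, -1), (s / (a * A * b), 1)).
  apply: (lstep_to (lalpha_unit P _)) (bT _ _ _ _) _ _; rewrite -/A; close_step.
have s2 : F ((A, -1), (s / (a * A * b), 1)) = ((k / A, 1), (k * a / c * b, 0)).
  apply: (lstep_to (aB _ _ _ _)) (bB _ _ _ _) _ _; close_step.
have y2 : 0 < k * a / c * b by rewrite !(divr_gt0, mulr_gt0).
have := aN0 _ y2; set A2 := alpha P _ => A20.
have s3 : F ((k / A, 1), (k * a / c * b, 0)) =
    ((A2 * A / k, -1), (s * c / (a ^+ 2 * A2 * A * b), 1)).
  apply: (lstep_to (lalpha_unit P _)) (bT _ _ _ _) _ _; rewrite -/A2; close_step.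
have s4 : F ((A2 * A / k, -1), (s * c / (a ^+ 2 * A2 * A * b), 1)) =
    ((k ^+ 2 / (A2 * A), 1), (k ^+ 2 * a ^+ 2 * b / c ^+ 2 , 0)).
  apply: (lstep_to (aB _ _ _ _)) (bB _ _ _ _) _ _; close_step.
rewrite !iterS s1 s2 s3 s4 => -[E1 E2].
have kac : (k * a / c) ^+ 2 = 1.
  by apply: (mulIf bN0); rewrite mul1r -[RHS]E2; field; nonzero.
have {}kac : k * a / c = 1.
  by apply/eqP; rewrite -(@eqrXn2 _ 2) ?expr1n ?kac // !(divr_ge0, mulr_ge0) ?ltW.
move: E1; rewrite /A2 kac mul1r -/A => E1.
apply/eqP; rewrite -(@eqrXn2 _ 2) ?ltW ?alpha_gt0 // -/A.
by rewrite -[k ^+ 2](divfK (mulf_neq0 A0 A0)) E1 mul1r.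
Qed.
(** k0 and k1 are the limits of the ratio of the two quadratics at 0 and at
infinity.  When they agree, subtracting k0 times the denominator from the
numerator leaves a multiple of y, since the extreme coefficients cancel. *)
Lemma balanced_ratio (a b c a' b' c' : R) :
  same_span (a != 0) (b != 0) (c != 0) (a' != 0) (b' != 0) (c' != 0) ->
  exists k0 k1 e, [/\
    forall y v, y != 0 -> 0 < v ->
      lmul (lquad a' b' c' (y, v)) (linv (lquad a b c (y, v))) = (k0, 0),
    forall y v, y != 0 -> v < 0 ->
      lmul (lquad a' b' c' (y, v)) (linv (lquad a b c (y, v))) = (k1, 0),
    k0 = k1 -> forall y, quad a' b' c' y = k0 * quad a b c y + e * y
  & e != 0 -> a != 0 /\ c != 0].
Proof.
have lm X Y k v : X / Y = k -> lmul (X, v) (linv (Y, v)) = (k, 0) :> R * int.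
  by move=> <-; rewrite /lmul /= subrr.
move=> /and4P[ne ne' sc sa].
have zero x x' y y' : x = 0 ->
    (if x != 0 then x' != 0 else ~~ (x' != 0) && ((y != 0) == (y' != 0))) ->
    x' = 0 /\ (y == 0) = (y' == 0).
  move=> ->; rewrite eqxx /= negbK => /andP[/eqP x'0 /eqP].
  by move/negb_inj.
have nonz x x' y y' : x != 0 ->
    (if x != 0 then x' != 0 else ~~ (x' != 0) && ((y != 0) == (y' != 0))) ->
    x' != 0 by move=> ->.
have [c0|cN0] := eqVneq c 0.
  have [c'0 bb] := zero _ _ _ _ c0 sc; subst c c'; rewrite eqxx !orbF in ne ne'.
  have [b0|bN0] := eqVneq b 0.
    have b'0 : b' = 0 by apply/eqP; rewrite -bb b0.
    subst b b'; rewrite eqxx !orbF in ne ne'.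
    exists (a' / a), (a' / a), 0; rewrite eqxx.
    split=> // [y v y0 v0|y v y0 v0|_ y].
    - by rewrite !lquad_square //; apply: lm; field; nonzero.
    - by rewrite !lquad_square //; apply: lm; field; nonzero.
    - by rewrite /quad; field.
  have b'N0 : b' != 0 by rewrite -bb.
  have [a0|aN0] := eqVneq a 0.
    have [a'0 _] := zero _ _ _ _ a0 sa; rewrite a0 a'0.
    exists (b' / b), (b' / b), 0; rewrite eqxx.
    split=> // [y v y0 v0|y v y0 v0|_ y].
    - by rewrite !lquad_linear_bottom //; apply: lm; field; nonzero.
    - by rewrite !lquad_linear_top //; apply: lm; field; nonzero.
    - by rewrite /quad; field.
  have a'N0 := nonz _ _ _ _ aN0 sa.
  exists (b' / b), (a' / a), 0; rewrite eqxx; split=> // [y v y0 v0|y v y0 v0|E y].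
  - by rewrite !lquad_linear_bottom //; apply: lm; field; nonzero.
  - by rewrite !lquad_top //; apply: lm; field; nonzero.
  - by rewrite /quad mulrDr mulrDr !mulrA {1}E !divfK //; ring.
have c'N0 := nonz _ _ _ _ cN0 sc.
have [a0|aN0] := eqVneq a 0.
  have [a'0 bb] := zero _ _ _ _ a0 sa; rewrite a0 a'0.
  have [b0|bN0] := eqVneq b 0.
    have b'0 : b' = 0 by apply/eqP; rewrite -bb b0.
    rewrite b0 b'0.
    exists (c' / c), (c' / c), 0; rewrite eqxx.
    split=> // [y v y0 v0|y v y0 v0|_ y].
    - by rewrite !lquad_const; apply: lm.
    - by rewrite !lquad_const; apply: lm.
    - by rewrite /quad; field.
  have b'N0 : b' != 0 by rewrite -bb.
  exists (c' / c), (b' / b), 0; rewrite eqxx; split=> // [y v y0 v0|y v y0 v0|E y].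
  - by rewrite !lquad_bottom //; apply: lm.
  - by rewrite !lquad_linear_top //; apply: lm; field; nonzero.
  - by rewrite /quad mulrDr mulrDr !mulrA {2}E !divfK //; ring.
have a'N0 := nonz _ _ _ _ aN0 sa.
exists (c' / c), (a' / a), (b' - c' / c * b); split=> // [y v y0 v0|y v y0 v0|E y].
- by rewrite !lquad_bottom //; apply: lm.
- by rewrite !lquad_top //; apply: lm; field; nonzero.
- by rewrite /quad mulrDr mulrDr !mulrA {1}E !divfK //; ring.
Qed.

Lemma balanced_alpha P : proper_walk P ->
  same_span (weight P 1 1 != 0) (weight P 1 0 != 0) (weight P 1 (-1) != 0)
    (weight P (-1) 1 != 0) (weight P (-1) 0 != 0) (weight P (-1) (-1) != 0) ->
  exists k0 k1 e, [/\ 0 < k0 /\ 0 < k1,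
    forall y v, y != 0 -> 0 < v -> lalpha P (y, v) = (k0, 0),
    forall y v, y != 0 -> v < 0 -> lalpha P (y, v) = (k1, 0),
    k0 = k1 -> forall y, 0 < y -> alpha P y =
      k0 + e * y / quad (weight P 1 1) (weight P 1 0) (weight P 1 (-1)) y
  & e != 0 -> 0 < weight P 1 1 /\ 0 < weight P 1 (-1)].
Proof.
move=> nd /balanced_ratio[k0 [k1 [e [B T E eN]]]].
have w_ge0 i j : 0 <= weight P i j by case: nd => [h _ _]; apply: h.
exists k0, k1, e; split=> [|//|//|k01 y y0|/eN[a0 c0]].
- have lp v := @lalpha_gt0 R P (1, v) nd ltr01; split.
    by have := lp 1; rewrite /lalpha B ?oner_neq0.
  by have := lp (-1); rewrite /lalpha T ?oner_neq0.
- have [_ [r1 _] _] := nd.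
  have q0 := quad_gt0 (w_ge0 1 1) (w_ge0 1 0) (w_ge0 1 (-1)) r1 y0.
  by rewrite /alpha E // mulrDl mulfK ?gt_eqF.
- by rewrite !lt_def a0 c0 !w_ge0.
Qed.

(** Along the orbit of (t, b), where beta only shows its limit value h0, the
ordinates alternate between b and h0/b while x is multiplied in total by
(alpha(h0/b)/alpha(b))^2. *)
Lemma alpha_reciprocal P h0 : proper_walk P -> period P 4 -> 0 < h0 ->
  (forall x u, x != 0 -> 0 < u -> lbeta P (x, u) = (h0, 0)) ->
  (forall x u, x != 0 -> u < 0 -> lbeta P (x, u) = (h0, 0)) ->
  forall b, 0 < b -> alpha P (h0 / b) = alpha P b.
Proof.
move=> nd p4 h0p bB bT b b0.
have [h0N bN0] : h0 != 0 /\ b != 0 by rewrite !gt_eqF.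
have := leading_period nd p4 (w := ((1 : R, 1 : int), (b, 0 : int))) ltr01 b0.
have aN0 y : 0 < y -> alpha P y != 0 by move=> y0; rewrite gt_eqF ?alpha_gt0.
set F := fun w => _; set z0 := (X in iter 4 _ X).
have := aN0 _ b0; have hb : 0 < h0 / b by rewrite divr_gt0.
have := aN0 _ hb; set A := alpha P b; set B := alpha P (h0 / b) => B0 A0.
have s1 : F z0 = ((A, -1), (h0 / b, 0)).
  apply: (lstep_to (lalpha_unit P _)) (bT _ _ _ _) _ _; rewrite -/A; close_step.
have s2 : F ((A, -1), (h0 / b, 0)) = ((B / A, 1), (b, 0)).
  apply: (lstep_to (lalpha_unit P _)) (bB _ _ _ _) _ _; rewrite -/B; close_step.
have s3 : F ((B / A, 1), (b, 0)) = ((A ^+ 2 / B, -1), (h0 / b, 0)).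
  apply: (lstep_to (lalpha_unit P _)) (bT _ _ _ _) _ _; rewrite -/A; close_step.
have s4 : F ((A ^+ 2 / B, -1), (h0 / b, 0)) = (((B / A) ^+ 2, 1), (b, 0)).
  apply: (lstep_to (lalpha_unit P _)) (bB _ _ _ _) _ _; rewrite -/B; close_step.
rewrite !iterS s1 s2 s3 s4 => -[E1].
suff BA : B / A = 1 by rewrite -[LHS](divfK A0 B) BA mul1r.
by apply/eqP; rewrite -(@eqrXn2 _ 2) ?expr1n ?E1 // ltW // divr_gt0 ?alpha_gt0.
Qed.

(** Eliminating x3 and y3 from the eight relations between consecutive points of
a closed orbit: x0 x1 = alpha(y0), y0 y1 = beta(x1), and so on. *)
Lemma period4_closed P x y : proper_walk P -> period P 4 -> 0 < x -> 0 < y ->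
  let x1 := alpha P y / x in let y1 := beta P x1 / y in
  let x2 := alpha P y1 / x1 in let y2 := beta P x2 / y1 in
  alpha P (beta P x / y) * alpha P y1 = alpha P y * alpha P y2.
Proof.
move=> nd p4 x0 y0 x1 y1 x2 y2.
have a_gt0 := @alpha_gt0 _ P _ nd; have b_gt0 := @beta_gt0 _ P _ nd.
have x1p : 0 < x1 by rewrite divr_gt0 ?a_gt0.
have y1p : 0 < y1 by rewrite divr_gt0 ?b_gt0.
have x2p : 0 < x2 by rewrite divr_gt0 ?a_gt0.
have y2p : 0 < y2 by rewrite divr_gt0 ?b_gt0.
pose x3 := alpha P y2 / x2; pose y3 := beta P x3 / y2.
have x3p : 0 < x3 by rewrite divr_gt0 ?a_gt0.
have y3p : 0 < y3 by rewrite divr_gt0 ?b_gt0.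
have F1 x' y' : 0 < x' -> 0 < y' -> flipy P (flipx P (x', y')) =
    (alpha P y' / x', beta P (alpha P y' / x') / y').
  move=> x'0 y'0; rewrite /flipx (_ : pos _) /=; last by rewrite /pos /= x'0.
  by rewrite /flipy (_ : pos _) //= /pos /= divr_gt0 ?a_gt0.
have := p4 (x, y); rewrite /pos /= x0 y0 => /(_ isT).
rewrite F1 // -/x1 -/y1 F1 // -/x2 -/y2 F1 // -/x3 -/y3 F1 // => -[E1 E2].
rewrite E1 in E2; have -> : beta P x / y = y3.
  by rewrite -E2; field; rewrite !gt_eqF ?b_gt0.
have -> : alpha P y3 = x * x3 by rewrite -E1; field; rewrite gt_eqF.
have -> : x3 = alpha P y2 * x1 / alpha P y1.
  by rewrite /x3 /x2; field; rewrite !gt_eqF ?a_gt0.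
by rewrite /x1; field; rewrite !gt_eqF ?a_gt0.
Qed.

End LeadingOrbits.

(** * Simultaneous perturbations of two constants *)

Section Perturbation.
Variable R : realType.
Implicit Types (P : 'M[R]_3).

Definition rlim (g : R -> R) (l : R) : Prop := g t @[t --> 0^'+] --> l.

Lemma rlim_cst c : rlim (fun=> c) c.
Proof. exact: cvg_cst. Qed.

Arguments rlim_cst : clear implicits.

Lemma rlim_id : rlim (fun t => t) 0.
Proof. by rewrite /rlim; exact: cvg_within. Qed.

Lemma rlimD (f g : R -> R) a b :
  rlim f a -> rlim g b -> rlim (fun t => f t + g t) (a + b).
Proof. by move=> fa gb; exact: cvgD fa gb. Qed.

Lemma rlimB (f g : R -> R) a b :
  rlim f a -> rlim g b -> rlim (fun t => f t - g t) (a - b).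
Proof. by move=> fa gb; exact: cvgB fa gb. Qed.

Lemma rlimM (f g : R -> R) a b :
  rlim f a -> rlim g b -> rlim (fun t => f t * g t) (a * b).
Proof. by move=> fa gb; exact: cvgM fa gb. Qed.

Lemma rlimV (f : R -> R) a : a != 0 -> rlim f a -> rlim (fun t => (f t)^-1) a^-1.
Proof. by move=> a0 fa; exact: cvgV a0 fa. Qed.

Lemma rlim_quad a b c f (l : R) :
  rlim f l -> rlim (fun t => quad a b c (f t)) (quad a b c l).
Proof.
move=> fl; have := rlimD (rlimD (rlimM (rlim_cst a) (rlimM fl fl))
  (rlimM (rlim_cst b) fl)) (rlim_cst c).
exact.
Qed.

Arguments rlim_quad a b c {f l}.

Lemma rlim_ext f g (l : R) : (forall t, 0 < t -> f t = g t) -> rlim f l -> rlim g l.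
Proof. exact: cvg_right_ext. Qed.

Lemma rlim_unique f (a b : R) : rlim f a -> rlim f b -> a = b.
Proof. by move=> fa fb; exact: cvg_unique fa fb. Qed.

(** Start at (t, b) with t tending to 0, and write rho = beta/h = 1 + x eta(x).
By the reciprocal symmetries of alpha and beta, the closing condition of
[period4_closed] reads
  alpha(b/r0) alpha(b/r1) = A alpha(b r2/r1),   A = alpha(b),
where r0 = rho(t), r1 = rho(k t/A), and r2 = rho(x2) with x2 equivalent to t.
If psi is the value of eta at 0 and G = b alpha'(b), the first-order terms in t
are -psi G and -(k/A) psi G on the left, and (1 - k/A) psi G on the right.  Hence
2 A psi G = 0; since b can be chosen with G <> 0 when e <> 0, psi, and with it f,
vanishes. *)
Lemma two_deformations P k h e f (a2 a1 a0 b2 b1 b0 : R) :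
  proper_walk P -> period P 4 -> 0 < k -> 0 < h ->
  0 < a2 -> 0 <= a1 -> 0 < a0 -> 0 < b2 -> 0 <= b1 -> 0 < b0 ->
  (forall y, 0 < y -> alpha P y = k + e * y / quad a2 a1 a0 y) ->
  (forall x, 0 < x -> beta P x = h + f * x / quad b2 b1 b0 x) ->
  (forall y, 0 < y -> alpha P (h / y) = alpha P y) ->
  (forall x, 0 < x -> beta P (k / x) = beta P x) ->
  e = 0 \/ f = 0.
Proof.
move=> nd p4 k0 h0 a2p a1p a0p b2p b1p b0p aE bE aS bS.
have [->|eN0] := eqVneq e 0; [by left|right].
have [b bp ab] : exists2 b, 0 < b & a0 - a2 * b ^+ 2 != 0.
  have [a02|a02] := eqVneq a0 a2; last first.
    by exists 1 => //; rewrite expr1n mulr1 subr_eq0.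
  exists 2 => //; rewrite a02 (_ : a2 - _ = - (3 * a2)); last by ring.
  by rewrite oppr_eq0 mulf_neq0 // gt_eqF.
have qa_gt0 y : 0 < y -> 0 < quad a2 a1 a0 y.
  by move=> y0; apply: quad_gt0 => //; [exact: ltW|exact: ltW|lra].
have qb_gt0 x : 0 < x -> 0 < quad b2 b1 b0 x.
  by move=> x0; apply: quad_gt0 => //; [exact: ltW|exact: ltW|lra].
have aD y y' : 0 < y -> 0 < y' -> alpha P y' = alpha P y +
    e * (y' - y) * (a0 - a2 * (y * y')) / (quad a2 a1 a0 y * quad a2 a1 a0 y').
  move=> y0 y'0; rewrite !aE //; have := qa_gt0 _ y0; have := qa_gt0 _ y'0.
  by rewrite /quad => /lt0r_neq0 q1 /lt0r_neq0 q2; field; rewrite q1 q2.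
pose A := alpha P b; have Ap : 0 < A by rewrite alpha_gt0.
have [hN kN AN bN] : [/\ h != 0, k != 0, A != 0 & b != 0] by rewrite !gt_eqF.
pose rho x := beta P x / h.
have rhop x : 0 < x -> 0 < rho x by move=> x0; rewrite divr_gt0 ?beta_gt0.
have hrho x : h * rho x = beta P x by rewrite mulrC divfK.
pose eta x := f / h / quad b2 b1 b0 x.
have rhoE x : 0 < x -> rho x = 1 + x * eta x.
  move=> x0; rewrite /rho bE // /eta; field.
  by rewrite hN gt_eqF ?qb_gt0.
pose psi := f / h / b0.
have eta_lim g : rlim g 0 -> rlim (fun t => eta (g t)) psi.
  move=> g0; apply: rlimM; first exact: rlim_cst.
  have -> : b0^-1 = (quad b2 b1 b0 0)^-1 by rewrite /quad expr2 !mulr0 !add0r.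
  apply: rlimV; last exact: rlim_quad.
  by rewrite /quad expr2 !mulr0 !add0r gt_eqF.
pose G := e * b * (a0 - a2 * (b * b)) / (quad a2 a1 a0 b * quad a2 a1 a0 b).
(* First-order expansion of alpha at b along a quotient of two functions that
   tend to 1. *)
have perturb (r r' u u' : R -> R) (l l' : R) : (forall t, 0 < t -> 0 < r t) ->
    (forall t, 0 < t -> 0 < r' t) -> (forall t, 0 < t -> r t = 1 + t * u t) ->
    (forall t, 0 < t -> r' t = 1 + t * u' t) -> rlim u l -> rlim u' l' ->
    exists2 E, forall t, 0 < t -> alpha P (b * (r t / r' t)) = A + t * E t
      & rlim E ((l - l') * G).
  move=> rp r'p rE r'E ul u'l.
  have lim1 (g : R -> R) (c : R) (v : R -> R) :
      rlim v c -> (forall t, 0 < t -> g t = 1 + t * v t) -> rlim g 1.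
    move=> vc gE; apply: rlim_ext (_ : rlim (fun t => 1 + t * v t) 1) => [t t0|].
      by rewrite gE.
    have := rlimD (rlim_cst 1) (rlimM rlim_id vc); by rewrite mul0r addr0.
  have r1 := lim1 _ _ _ ul rE; have r'1 := lim1 _ _ _ u'l r'E.
  have one0 : (1 : R) != 0 := oner_neq0 _.
  have m1 : rlim (fun t => b * (r t / r' t)) b.
    have := rlimM (rlim_cst b) (rlimM r1 (rlimV one0 r'1)).
    by rewrite invr1 !mulr1.
  exists (fun t => (u t - u' t) * (r' t)^-1 *
     (e * b * (a0 - a2 * (b * (b * (r t / r' t)))) /
      (quad a2 a1 a0 b * quad a2 a1 a0 (b * (r t / r' t))))) => [t t0|].
    have r't := r'p t t0; have bm : 0 < b * (r t / r' t).
      by rewrite mulr_gt0 // divr_gt0 ?rp.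
    rewrite (aD b) //; congr (_ + _).
    have -> : b * (r t / r' t) - b = b * t * (u t - u' t) / r' t.
      by move: r't; rewrite rE // r'E // => r't; field; rewrite gt_eqF.
    move: (b * (r t / r' t)) bm => y' /qa_gt0 q'; have q0 := qa_gt0 _ bp.
    by field; rewrite !gt_eqF.
  have := rlimM (rlimM (rlimB ul u'l) (rlimV one0 r'1))
    (rlimM (rlimM (rlim_cst (e * b))
    (rlimB (rlim_cst a0) (rlimM (rlim_cst a2) (rlimM (rlim_cst b) m1))))
    (rlimV _ (rlimM (rlim_cst (quad a2 a1 a0 b)) (rlim_quad a2 a1 a0 m1)))).
  rewrite invr1 mulr1; apply.
  by rewrite mulf_neq0 // gt_eqF ?qa_gt0.
pose r0 t := rho t; pose r1 t := rho (k / A * t).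
have kA : 0 < k / A by rewrite divr_gt0.
have r0p t : 0 < t -> 0 < r0 t by exact: rhop.
have r1p t : 0 < t -> 0 < r1 t by move=> t0; apply: rhop; rewrite mulr_gt0.
have r0E t : 0 < t -> r0 t = 1 + t * eta t by exact: rhoE.
have r1E t : 0 < t -> r1 t = 1 + t * (k / A * eta (k / A * t)).
  by move=> t0; rewrite /r1 (rhoE _ (mulr_gt0 kA t0)) [t * _]mulrA [t * _]mulrC.
have lim_kAt : rlim (fun t => k / A * t) 0.
  by have := rlimM (rlim_cst (k / A)) rlim_id; rewrite mulr0.
have u0 : rlim eta psi by exact: eta_lim rlim_id.
have u1 : rlim (fun t => k / A * eta (k / A * t)) (k / A * psi).
  exact: rlimM (rlim_cst _) (eta_lim _ lim_kAt).
pose one (t : R) : R := 1.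
have one_p t : 0 < t -> 0 < one t by [].
have one_E t : 0 < t -> one t = 1 + t * (fun=> 0) t by rewrite mulr0 addr0.
have [E0 E0E E0l] :=
  perturb one _ (fun=> 0) _ _ _ one_p r0p one_E r0E (rlim_cst 0) u0.
have [E1 E1E E1l] :=
  perturb one _ (fun=> 0) _ _ _ one_p r1p one_E r1E (rlim_cst 0) u1.
(* With x1 = A/t, the abscissa x2 = alpha(y1)/x1 is t * s t. *)
pose s t := 1 + t * E1 t / A; pose r2 t := rho (t * s t).
have sE t : 0 < t -> s t = alpha P (b * (1 / r1 t)) / A.
  by move=> t0; rewrite E1E // mulrDl divff.
have sp t : 0 < t -> 0 < s t.
  by move=> t0; rewrite sE // divr_gt0 // alpha_gt0 // mulr_gt0 // divr_gt0 // r1p.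
have s1 : rlim s 1.
  have := rlimD (rlim_cst 1) (rlimM (rlimM rlim_id E1l) (rlim_cst A^-1)).
  by rewrite !mul0r addr0.
have r2p t : 0 < t -> 0 < r2 t by move=> t0; apply: rhop; rewrite mulr_gt0 ?sp.
have r2E t : 0 < t -> r2 t = 1 + t * (s t * eta (t * s t)).
  by move=> t0; rewrite /r2 rhoE ?mulr_gt0 ?sp // mulrA.
have u2 : rlim (fun t => s t * eta (t * s t)) psi.
  rewrite -[psi]mul1r; apply: (rlimM s1 (eta_lim _ _)).
  by have := rlimM rlim_id s1; rewrite mul0r.
have [E2 E2E E2l] := perturb _ _ _ _ _ _ r2p r1p r2E r1E u2 u1.
have closed t : 0 < t -> A * (E0 t + E1 t - E2 t) + t * (E0 t * E1 t) = 0.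
  move=> t0; have /= := period4_closed nd p4 t0 bp; rewrite -/A.
  have bq (r : R) : 0 < r -> 0 < b * (1 / r).
    by move=> rp; rewrite mulr_gt0 ?divr_gt0.
  have At0 : 0 < A / t by rewrite divr_gt0.
  have bx1 : beta P (A / t) = h * r1 t.
    rewrite -bS // (_ : k / (A / t) = k / A * t); last by field; rewrite AN gt_eqF.
    by rewrite /r1 hrho.
  have ay1 : alpha P (beta P (A / t) / b) = A * s t.
    rewrite bx1 (_ : h * r1 t / b = h / (b * (1 / r1 t))); last first.
      by field; rewrite bN gt_eqF ?r1p.
    by rewrite aS ?bq ?r1p // sE // [RHS]mulrC divfK.
  have x2E : alpha P (beta P (A / t) / b) / (A / t) = t * s t.
    by rewrite ay1; field; rewrite AN gt_eqF.
  have y2E : beta P (t * s t) / (h * r1 t / b) = b * (r2 t / r1 t).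
    rewrite (_ : beta P (t * s t) = h * r2 t); last by rewrite /r2 hrho.
    by field; rewrite hN bN gt_eqF ?r1p.
  have y3E : alpha P (beta P t / b) = alpha P (b * (1 / r0 t)).
    rewrite -(aS (b * (1 / r0 t))) ?bq ?r0p //; congr (alpha P _).
    rewrite (_ : beta P t = h * r0 t); last by rewrite /r0 hrho.
    by field; rewrite bN gt_eqF ?r0p.
  rewrite x2E ay1 bx1 y2E y3E [alpha P (b * (1 / _))](E0E t t0) E2E // /s => E.
  apply: (mulfI (lt0r_neq0 t0)); rewrite mulr0.
  have -> : t * (A * (E0 t + E1 t - E2 t) + t * (E0 t * E1 t)) =
     (A + t * E0 t) * (A * (1 + t * E1 t / A)) - A * (A + t * E2 t).
    by field; exact: AN.
  by rewrite E subrr.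
have lim0 := rlim_ext closed (rlimD (rlimM (rlim_cst A)
  (rlimB (rlimD E0l E1l) E2l)) (rlimM rlim_id (rlimM E0l E1l))).
have E := rlim_unique lim0 (rlim_cst 0).
have G0 : G != 0.
  by have := lt0r_neq0 (qa_gt0 _ bp) => q0; rewrite /G -expr2; nonzero.
have psi0 : psi * (2 * A * G) = 0 by rewrite -[RHS]oppr0 -[in RHS]E; ring.
have AG0 : 2 * A * G != 0.
  by rewrite (mulf_neq0 _ G0) // (mulf_neq0 _ AN) ?pnatr_eq0.
have psi_eq0 : psi = 0 by apply: (mulIf AG0); rewrite psi0 mul0r.
apply/eqP; move/eqP: psi_eq0.
by rewrite !mulf_eq0 !invr_eq0 (negPf hN) (gt_eqF b0p) !orbF.
Qed.
End Perturbation.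

(** * Walks of order 8 *)

Section Conclusion.
Variable R : realType.
Implicit Types (P Q : 'M[R]_3) (l m : R * int) (x y : R) (u v : int).

(** The orbit of (t, t) shows that alpha and beta have the same limits at 0 and
at infinity, so both are perturbations of constants, one of them trivial. *)
Lemma balanced_support_period2 P : proper_walk P -> on_support P balanced_support ->
  period P 4 -> period P 2.
Proof.
move=> nd /andP[/(balanced_alpha nd)[k0 [k1 [e [[k0p k1p] aB aT aE eN]]]]].
have ndt := proper_walk_tr nd; rewrite -!(weight_tr P) => /(balanced_alpha ndt).
move=> [h0 [h1 [f [[h0p h1p] bB bT bE fN]]]] p4.
have [k0N k1N h0N h1N] : [/\ k0 != 0, k1 != 0, h0 != 0 & h1 != 0].
  by rewrite !gt_eqF.
have k01 : k0 = k1 /\ h0 = h1.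
  have := leading_period nd p4 (w := ((1 : R, 1 : int), (1 : R, 1 : int)))
    ltr01 ltr01.
  set F := fun w => _; set z0 := (X in iter 4 _ X).
  have s1 : F z0 = ((k0, -1), (h1, -1)).
    apply: (lstep_to (aB _ _ _ _)) (bT _ _ _ _) _ _; close_step.
  have s2 : F ((k0, -1), (h1, -1)) = ((k1 / k0, 1), (h0 / h1, 1)).
    apply: (lstep_to (aT _ _ _ _)) (bB _ _ _ _) _ _; close_step.
  have s3 : F ((k1 / k0, 1), (h0 / h1, 1)) =
      ((k0 ^+ 2 / k1, -1), (h1 ^+ 2 / h0, -1)).
    apply: (lstep_to (aB _ _ _ _)) (bT _ _ _ _) _ _; close_step.
  have s4 : F ((k0 ^+ 2 / k1, -1), (h1 ^+ 2 / h0, -1)) =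
      (((k1 / k0) ^+ 2, 1), ((h0 / h1) ^+ 2, 1)).
    apply: (lstep_to (aT _ _ _ _)) (bB _ _ _ _) _ _; close_step.
  rewrite !iterS s1 s2 s3 s4 => -[E1 E2].
  have sq1 x : 0 < x -> x ^+ 2 = 1 -> x = 1.
    by move=> x0 E; apply/eqP; rewrite -(@eqrXn2 _ 2) ?expr1n ?E // ltW.
  split; first by rewrite -[RHS](divfK k0N k1) (sq1 (k1 / k0)) ?mul1r // divr_gt0.
  by rewrite -[LHS](divfK h1N h0) (sq1 (h0 / h1)) ?mul1r // divr_gt0.
case: k01 aT aE bT bE => <- <- aT /(_ erefl) aE bT /(_ erefl) bE {k1p h1p k1N h1N}.
have p4t := period_tr nd p4.
have aS : forall y, 0 < y -> alpha P (h0 / y) = alpha P y.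
  exact: alpha_reciprocal nd p4 h0p bB bT.
have bS : forall x, 0 < x -> beta P (k0 / x) = beta P x.
  apply: alpha_reciprocal ndt p4t k0p _ _ => x u; rewrite /lbeta trmxK.
    exact: aB.
  exact: aT.
have w_ge0 (S : 'M[R]_3) i j : proper_walk S -> 0 <= weight S i j.
  by case=> [p _ _]; apply: p.
have alpha_const : e = 0 -> period P 2.
  move=> e0; apply: (@constant_alpha_period2 _ P k0) => // y y0.
  by rewrite aE // e0 !mul0r addr0.
have beta_const : f = 0 -> period P 2.
  move=> f0; rewrite -[P]trmxK; apply: period_tr => //.
  apply: (@constant_alpha_period2 _ P^T h0) => // y y0.
  by rewrite bE // f0 !mul0r addr0.
have [/alpha_const //|/eN[a2p a0p]] := eqVneq e 0.
have [/beta_const //|/fN[b2p b0p]] := eqVneq f 0.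
have [] := two_deformations nd p4 k0p h0p a2p (w_ge0 _ _ _ nd) a0p
  b2p (w_ge0 _ _ _ ndt) b0p aE bE aS bS.
  exact: alpha_const.
exact: beta_const.
Qed.

Lemma period4_form P : proper_walk P -> period P 4 -> ~ period P 2 ->
  exists Q, symmetric_to P Q /\
    [/\ [/\ weight Q 1 1 = 0, weight Q 0 1 = 0,
            weight Q (-1) (-1) = 0 & weight Q 0 (-1) = 0],
        weight Q 1 0 * weight Q (-1) 0 = weight Q 1 (-1) * weight Q (-1) 1
      & weight Q 1 0 * weight Q 1 (-1) * weight Q (-1) 1 != 0].
Proof.
move=> nd p4 p2; case: (period_support nd p4) => [b|[Q PQ]].
  by case: p2; exact: balanced_support_period2 b p4.
have [ndQ E4] := symmetric_period 4 nd PQ; have [_ E2] := symmetric_period 2 nd PQ.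
have p4Q := E4.1 p4; case/or3P => [mo|sk|tri].
- exists Q; split=> //; split; last 2 first.
  + exact: monomial_support_product.
  + move: mo; rewrite /on_support => /and5P[_ q0 p0 _ /and4P[_ r0 _ _]].
    by rewrite !mulf_neq0.
  + move: mo; rewrite /on_support => /and5P[/negPn/eqP-> _ _ /negPn/eqP->].
    by move=> /and4P[/negPn/eqP-> _ _ /negPn/eqP->].
- by case: (skew_support_no_period4 ndQ sk p4Q).
- by case: p2; apply/E2; exact: tripod_support_period2 tri p4Q.
Qed.

(** alpha and beta are the monomials A y and B x^2, and the square of the
rotation is (x, y) -> (A^2 B/x, A^2 B^2/y), an involution other than the
identity. *)
Lemma form_period4 Q : proper_walk Q ->
  [/\ weight Q 1 1 = 0, weight Q 0 1 = 0,
      weight Q (-1) (-1) = 0 & weight Q 0 (-1) = 0] ->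
  weight Q 1 0 * weight Q (-1) 0 = weight Q 1 (-1) * weight Q (-1) 1 ->
  weight Q 1 0 * weight Q 1 (-1) * weight Q (-1) 1 != 0 ->
  period Q 4 /\ ~ period Q 2.
Proof.
move=> nd [w11 w01 wmm w0m] E N.
have w_ge0 i j : 0 <= weight Q i j by case: nd => [p _ _]; apply: p.
set q := weight Q 1 0 in E N; set p := weight Q 1 (-1) in E N.
set r := weight Q (-1) 1 in E N; set s := weight Q (-1) 0 in E.
have [q0 p0 r0] : [/\ q != 0, p != 0 & r != 0].
  by move: N; rewrite !mulf_eq0 !negb_or => /andP[/andP[-> ->] ->].
have [qp pp rp] : [/\ 0 < q, 0 < p & 0 < r] by rewrite !lt_def q0 p0 r0 !w_ge0.
have sE : s = p * r / q by rewrite -E; field.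
have aE y : 0 < y -> alpha Q y = r / q * y.
  move=> y0; have qy : q * y + p != 0 by rewrite gt_eqF // addr_gt0 ?mulr_gt0.
  rewrite /alpha /quad w11 wmm -/q -/p -/r -/s sE !mul0r add0r addr0.
  by field; rewrite q0 qy.
have bE x : 0 < x -> beta Q x = p / r * x ^+ 2.
  move=> x0; rewrite /beta /alpha /quad !weight_tr w11 w01 wmm w0m -/r -/p.
  by rewrite !mul0r !add0r !addr0; field.
set A := r / q in aE; set B := p / r in bE.
have [Ap Bp] : 0 < A /\ 0 < B by rewrite !divr_gt0.
clearbody A B.
have step (x y x' y' : R) : 0 < x -> 0 < y -> x' = A * y / x ->
    y' = B * x' ^+ 2 / y -> flipy Q (flipx Q (x, y)) = (x', y').
  move=> x0 y0 Ex Ey; rewrite /flipx (_ : pos _) /=; last by rewrite /pos /= x0.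
  have x'0 : 0 < x' by rewrite Ex divr_gt0 ?mulr_gt0.
  rewrite aE // -Ex /flipy (_ : pos _) /= ?bE -?Ey //.
  by rewrite /pos /= x'0.
have F2 (x y : R) : 0 < x -> 0 < y ->
    flipy Q (flipx Q (flipy Q (flipx Q (x, y)))) =
    (A ^+ 2 * B / x, A ^+ 2 * B ^+ 2 / y).
  move=> x0 y0; have [xN yN] : x != 0 /\ y != 0 by rewrite !gt_eqF.
  have [AN BN] : A != 0 /\ B != 0 by rewrite !gt_eqF.
  rewrite (step x y (A * y / x) (B * A ^+ 2 * y / x ^+ 2)) //; last first.
    by field; nonzero.
  apply: step; [| |by field; nonzero..].
    by rewrite divr_gt0 ?mulr_gt0.
  by rewrite divr_gt0 ?mulr_gt0 ?exprn_gt0.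
have [C0 D0] : 0 < A ^+ 2 * B /\ 0 < A ^+ 2 * B ^+ 2.
  by rewrite !mulr_gt0 ?exprn_gt0.
split=> [[x y] /andP[/= x0 y0]|p2].
  rewrite !F2 ?divr_gt0 //.
  by congr pair; field; rewrite !gt_eqF.
have := p2 (1, 1); have := p2 (2, 1).
rewrite /pos /= ltr01 ltr0n /= !F2 // => /(_ isT)[E2 _] /(_ isT)[E1 _].
by move: E1 E2; rewrite divr1 => ->; lra.
Qed.
End Conclusion.

Lemma weighted_walk_proper (R : realType) (P : 'M[R]_3) : weighted_walk P ->
  coefA1 P != 0 -> coefC1 P != 0 -> coefA2 P != 0 -> coefC2 P != 0 ->
  proper_walk P.
Proof.
move=> [hP _] hA1 hC1 hA2 hC2.
have w_ge0 i j : 0 <= P i j.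
  have [i' si <-] := step_index_surj i; have [j' sj <-] := step_index_surj j.
  exact: hP.
have w_ge0' i j : 0 <= weight P i j by apply: w_ge0.
have mass (w : int -> R) (v : ratfun R) : (forall j, 0 <= w j) ->
    \sum_(j <- steps) cst (w j) * v ^ j != 0 -> 0 < w 1 + w 0 + w (-1).
  move=> w0 nz; rewrite lt_def !addr_ge0 // andbT; apply: contra nz.
  rewrite !paddr_eq0 ?addr_ge0 // => /andP[/andP[/eqP w1 /eqP w00] /eqP wm].
  by rewrite /steps !big_cons big_nil w1 w00 wm rmorph0 !mul0r !addr0.
split=> //; split; rewrite /row_mass ?weight_tr.
- exact: mass hA1.
- exact: mass hC1.
- exact: (mass (weight P ^~ 1)) hA2.
- exact: (mass (weight P ^~ (-1))) hC2.
Qed.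

Lemma mx3_form (R : realFieldType) (Q : 'M[R]_3) : weight Q 1 0 != 0 ->
  Q = mx3
    [:: [:: 0; weight Q 1 0; weight Q 1 (-1)];
        [:: 0; weight Q 0 0; 0];
        [:: weight Q (-1) 1;
            weight Q 1 (-1) * weight Q (-1) 1 / weight Q 1 0; 0]] <->
  [/\ weight Q 1 1 = 0, weight Q 0 1 = 0,
      weight Q (-1) (-1) = 0 & weight Q 0 (-1) = 0] /\
  weight Q 1 0 * weight Q (-1) 0 = weight Q 1 (-1) * weight Q (-1) 1.
Proof.
move=> q0; have wE (s : seq (seq R)) (i j : int) :
    weight (mx3 s) i j = (nth [::] s (step_index i))`_(step_index j).
  by rewrite /weight mxE.
have idx : [/\ step_index 1 = 0%N :> nat, step_index 0 = 1%N :> nat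
    & step_index (-1) = 2%N :> nat] by rewrite !inordK.
case: idx => i1 i0 im; split=> [E|[[w11 w01 wmm w0m] E]].
  split; first by split; rewrite E wE ?i1 ?i0 ?im.
  by rewrite {2}E wE im i0 /= mulrC divfK.
apply: matrix_weight_inj => i j; rewrite !inE => /or3P[] /eqP-> /or3P[] /eqP->;
  rewrite wE ?i1 ?i0 ?im //=.
by rewrite -E mulrC mulKf.
Qed.

Theorem theorem5p1 (R : realType) (P : 'M[R]_3)
    (hP : weighted_walk P)
    (hA1 : coefA1 P != 0) (hC1 : coefC1 P != 0)
    (hA2 : coefA2 P != 0) (hC2 : coefC2 P != 0) :
  (walk_group P #= `I_8 <->
     exists Q : 'M[R]_3, symmetric_to P Q /\
       [/\ [/\ weight Q 1 1 = 0, weight Q 0 1 = 0,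
               weight Q (-1) (-1) = 0 & weight Q 0 (-1) = 0],
           weight Q 1 0 * weight Q (-1) 0 = weight Q 1 (-1) * weight Q (-1) 1
         & weight Q 1 0 * weight Q 1 (-1) * weight Q (-1) 1 != 0])
  /\
  (walk_group P #= `I_8 <->
     exists Q : 'M[R]_3, symmetric_to P Q /\
       Q = mx3
         [:: [:: 0; weight Q 1 0; weight Q 1 (-1)];
             [:: 0; weight Q 0 0; 0];
             [:: weight Q (-1) 1;
                 weight Q 1 (-1) * weight Q (-1) 1 / weight Q 1 0; 0]] /\
       weight Q 1 0 * weight Q 1 (-1) * weight Q (-1) 1 != 0).
Proof.
have nd := weighted_walk_proper hP hA1 hC1 hA2 hC2.
pose form (Q : 'M[R]_3) := [/\ [/\ weight Q 1 1 = 0, weight Q 0 1 = 0,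
               weight Q (-1) (-1) = 0 & weight Q 0 (-1) = 0],
           weight Q 1 0 * weight Q (-1) 0 = weight Q 1 (-1) * weight Q (-1) 1
         & weight Q 1 0 * weight Q 1 (-1) * weight Q (-1) 1 != 0].
have main : walk_group P #= `I_8 <-> exists Q, symmetric_to P Q /\ form Q.
  rewrite (card_walk_group nd); split=> [[p4 p2]|[Q [PQ [Z E N]]]].
    exact: period4_form.
  have [ndQ E4] := symmetric_period 4 nd PQ.
  have [_ E2] := symmetric_period 2 nd PQ.
  by rewrite E4 E2; exact: form_period4.
split; first exact: main.
rewrite main; split=> -[Q [PQ]].
  move=> [Z E N]; exists Q; split=> //; split=> //; apply/mx3_form => //.
  by apply: contraNneq N => ->; rewrite !mul0r.
move=> [E N]; exists Q; split=> //; move/mx3_form: E => E.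
have [|Z EQ] := E _; first by apply: contraNneq N => ->; rewrite !mul0r.
by split.
Qed.
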